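(* Let $N\ge1$, let $\Omega\subset\mathbb{R}^N$ be a smooth bounded domain, and let $f:\mathbb{R}\to\mathbb{R}$ be continuous with $F(t)=\int_0^tf(s)\,ds$. Consider the conditions: ($f_1$) there exist constants $2<p<2^*$, $0\le K_2<\lambda_{1,0,0}$ and $K_p\ge0$ with $|f(t)|\le K_2|t|+K_p|t|^{p-1}$ for all $t\in\mathbb{R}$; ($f_2$) $f(t)t\ge0$ and $t\mapsto f(t)/|t|$ is non-decreasing on $(-\infty,0)\cup(0,+\infty)$; ($f_3$) $\lim_{|t|\to+\infty}F(t)/t^2=+\infty$; ($f_4$) there exists $q>2$ with $0\le qF(t)\le f(t)t$ for all $t\in\mathbb{R}$. Assume that either ($f_1$), ($f_2$), ($f_3$) hold and $0<\mu<\mu_0$, or ($f_1$), ($f_2$), ($f_4$) hold and $0<\mu\le\mu^*$, where $\mu_0$ and $\mu^*$ are the thresholds of the two existence theorems recalled in the context. Let $(u,\lambda_u)\in H^1_0(\Omega)\times[0,\lambda_{1,0,0}]$ denote the solution of $$-\Delta u=\lambda u+f(u)\ \text{ in }\Omega,\qquad u\in H^1_0(\Omega),\qquad \int_\Omega u^2\,dx=\mu$$ obtained in the corresponding existence theorem. Then $u$ satisfies $$E(u)=\inf_{w\in\mathcal S^+(\mu)}E(w)=\inf_{w\in\mathcal N^+(\mu)}E(w).$$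
   Context: $\lambda_{1,0,0}$ is the first eigenvalue of $-\Delta$ on $H^1_0(\Omega)$; $2^*=\frac{2N}{N-2}$ if $N\ge3$, $2^*=+\infty$ if $N=1,2$; $\|u\|=\|\nabla u\|_2$ on $H^1_0(\Omega)$; $E(u)=\frac12\|u\|^2-\int_\Omega F(u)\,dx$; $S_{1,0,0}(\mu)=\{u\in H^1_0(\Omega):\int_\Omega u^2dx=\mu\}$; $$\mathcal S^+(\mu)=\{u\in S_{1,0,0}(\mu):\langle E'(u),v\rangle=\lambda_u\textstyle\int_\Omega uv\,dx\ \forall v\in H_0^1(\Omega),\text{ for some }\lambda_u\ge0\},$$ $$\mathcal N^+(\mu)=\{u\in S_{1,0,0}(\mu):\langle E'(u),u\rangle\ge0\}.$$ The two existence theorems. (A) If ($f_1$)-($f_3$) hold, there exists $\mu_0>0$ depending only on $\Omega$ and $f$ such that for all $0<\mu<\mu_0$ the problem has a solution $(u,\lambda)\in H^1_0(\Omega)\times[0,\lambda_{1,0,0}]$. (B) If ($f_1$) and ($f_4$) hold, the problem has a solution $(u,\lambda)\in H^1_0(\Omega)\times[0,\lambda_{1,0,0}]$ for all $0<\mu\le\mu^*$, where $$\mu^*=\left(\frac{\lambda_{1,0,0}-K_2}{K_pC_{p,N}}\right)^{\frac2{p-2}}\lambda_{1,0,0}^{-\frac N2}\ \text{ if }2<p\le2+\tfrac4N,\qquad \mu^*=\left(\frac{\lambda_{1,0,0}-K_2}{K_pC_{p,N}}\right)^{\frac2{p-2}}\left(\frac q{q-2}\right)^{\frac2{p-2}-\frac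 N2}\lambda_{1,0,0}^{-\frac N2}\ \text{ if }2+\tfrac4N<p<2^*,$$ and $C_{p,N}>0$ is a constant depending only on $p,N$ with $\|u\|_p^p\le C_{p,N}\|u\|_2^{(1-\beta_p)p}\|\nabla u\|_2^{\beta_pp}$ on $H^1_0(\Omega)$, $\beta_p=N(\frac12-\frac1p)$. ''The solution obtained'' in (A) or (B) is the one constructed there by the perturbation method, as follows. For $r>1$ let $f_r(s)=\frac{s^r}{1-s}$ on $[0,1)$, $U_\mu=\{u\in H^1_0(\Omega):\|u\|_2^2<\mu\}$, $E_{r,\mu}(u)=E(u)-f_r(\|u\|_2^2/\mu)$ on $U_\mu$, and $c_r=\inf_\gamma\max_{t\in[0,1]}E_{r,\mu}(\gamma(t))$ over $\gamma\in C([0,1],U_\mu)$ with $\gamma(0)=0$, $E_{r,\mu}(\gamma(1))<0$. For $r$ large there is a critical point $u_r\in U_\mu$ of $E_{r,\mu}$ with $E_{r,\mu}(u_r)=c_r$; along some sequence $r_n\nearrow+\infty$ one has $u_{r_n}\to u$ in $H^1_0(\Omega)$ and $\frac2\mu f_{r_n}'(\|u_{r_n}\|_2^2/\mu)\to\lambda_u$, and $(u,\lambda_u)$ is the solution. *)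

(* Defs.v *)
From HB Require Import structures.
From mathcomp Require Import all_boot all_order all_algebra.
From mathcomp Require Import all_classical all_reals all_analysis.
Import Order.TTheory GRing.Theory Num.Theory.
Import numFieldTopology.Exports numFieldNormedType.Exports.

Set Implicit Arguments.
Unset Strict Implicit.
Unset Printing Implicit Defensive.

Local Open Scope classical_set_scope.
Local Open Scope ring_scope.

(* Lebesgue measure on R^n.  The sigma-algebra on 'rV[T]_n is generated by the
   coordinates; for T = R it is the Borel sigma-algebra. *)

Definition measure_rV_display : measure_display -> measure_display.
Proof. exact. Qed.

Section measurable_rV.
Context {d} {T : sigmaRingType d}.
Variable n : nat.

Let coors : 'I_n -> 'rV[T]_n -> T := fun i x => x ord0 i.

Let rV_set0 : g_sigma_preimage coors set0.
Proof. exact: sigma_algebra0. Qed.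

Let rV_setC A : g_sigma_preimage coors A -> g_sigma_preimage coors (~` A).
Proof. exact: sigma_algebraC. Qed.

Let rV_bigcup (F : _^nat) : (forall i, g_sigma_preimage coors (F i)) ->
  g_sigma_preimage coors (\bigcup_i (F i)).
Proof. exact: sigma_algebra_bigcup. Qed.

HB.instance Definition _ := @isMeasurable.Build (measure_rV_display d)
  'rV[T]_n (g_sigma_preimage coors) rV_set0 rV_setC rV_bigcup.

End measurable_rV.

Section lebesgue_rV.
Context {R : realType}.

Lemma measurable_coord n (i : 'I_n) :
  measurable_fun [set: 'rV[R]_n] (fun x => x ord0 i).
Proof.
move=> _ Y mY; rewrite setTI; apply: sub_sigma_algebra => /=.
rewrite -bigcup_seq/=; exists i => /=; first by rewrite mem_index_enum.
by exists Y => //; rewrite setTI.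
Qed.

Lemma measurable_rVP d (T : measurableType d) n (g : T -> 'rV[R]_n) :
  (forall i, measurable_fun [set: T] (fun x => g x ord0 i)) ->
  measurable_fun [set: T] g.
Proof.
move=> mg; apply: (@measurability _ _ _ _ setT g
  (\big[setU/set0]_(i < n) preimage_set_system setT
     (fun x : 'rV[R]_n => x ord0 i) measurable)) => //.
move=> _ [B + <-]; rewrite -bigcup_seq => -[i /= _ [A mA <-]].
by move: (mg i measurableT A mA); rewrite !setTI.
Qed.

Definition rV_cons n (xy : R * 'rV[R]_n) : 'rV[R]_n.+1 := row_mx xy.1%:M xy.2.

Lemma measurable_rV_cons n :
  measurable_fun [set: R * 'rV[R]_n] (@rV_cons n).
Proof.
apply: measurable_rVP => i; rewrite /rV_cons.
case: (split_ordP (i : 'I_(1 + n))) => j ->.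
  rewrite (_ : (fun _ => _) = fst); first exact: measurable_fst.
  by apply/funext => -[x y] /=; rewrite [LHS](row_mxEl _ y) mxE !ord1 mulr1n.
rewrite (_ : (fun _ => _) = (fun y : 'rV[R]_n => y ord0 j) \o snd).
  exact: (measurableT_comp (measurable_coord j) measurable_snd).
by apply/funext => -[x y] /=; exact: (row_mxEr x%:M).
Qed.

Section cons_measure.
Local Open Scope ereal_scope.
Variables (n : nat) (mu : {sigma_finite_measure set 'rV[R]_n -> \bar R}).

Definition cons_measure : set 'rV[R]_n.+1 -> \bar R :=
  pushforward (lebesgue_measure \x mu) (@rV_cons n).

Let cons_measure0 : cons_measure set0 = 0.
Proof. by rewrite /cons_measure /pushforward preimage_set0 measure0. Qed.

Let cons_measure_ge0 A : 0 <= cons_measure A.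
Proof. by rewrite /cons_measure /pushforward; exact: measure_ge0. Qed.

Let cons_measure_sigma_additive : semi_sigma_additive cons_measure.
Proof.
move=> F mF tF mUF; rewrite /cons_measure /pushforward preimage_bigcup.
apply: measure_semi_sigma_additive.
- by move=> k; rewrite -[X in measurable X]setTI; exact: measurable_rV_cons.
- apply/trivIsetP => /= i j _ _ ij; rewrite -preimage_setI.
  by move/trivIsetP : tF => /(_ _ _ _ _ ij) ->//; rewrite preimage_set0.
- rewrite -preimage_bigcup -[X in measurable X]setTI.
  exact: measurable_rV_cons.
Qed.

HB.instance Definition _ := isMeasure.Build _ _ _ cons_measure
  cons_measure0 cons_measure_ge0 cons_measure_sigma_additive.

Let uncons (z : 'rV[R]_n.+1) : R * 'rV[R]_n :=
  (z ord0 ord0, \row_i z ord0 (lift ord0 i)).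

Let measurable_uncons : measurable_fun setT uncons.
Proof.
apply/measurable_fun_pair; first exact: measurable_coord.
apply: measurable_rVP => i; under eq_fun do rewrite mxE.
exact: measurable_coord.
Qed.

Let rV_consK : cancel (@rV_cons n) uncons.
Proof.
move=> [x y]; rewrite /uncons /rV_cons; congr (_, _).
  rewrite (_ : ord0 = @lshift 1 n ord0); last exact: val_inj.
  by rewrite [LHS](row_mxEl _ y) mxE mulr1n.
apply/rowP => i; rewrite mxE.
rewrite (_ : lift ord0 i = @rshift 1 n i); last exact: val_inj.
exact: (row_mxEr x%:M).
Qed.

Let cons_measure_sigma_finite : sigma_finite setT cons_measure.
Proof.
have /sigma_finiteP[F [TF ndF Foo]] :=
  sigma_finiteT (lebesgue_measure : {sigma_finite_measure set _ -> \bar R}).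
have /sigma_finiteP[G [TG ndG Goo]] := sigma_finiteT mu.
exists (fun k => uncons @^-1` (F k `*` G k)).
  rewrite -preimage_bigcup (_ : \bigcup_k _ = setT) ?preimage_setT//.
  rewrite -subTset => -[x y] _.
  have [i _ Fi] : (\bigcup_i F i) x by rewrite -TF.
  have [j _ Gj] : (\bigcup_i G i) y by rewrite -TG.
  exists (maxn i j) => //; split => /=.
  - by move: x Fi; exact/subsetPset/ndF/leq_maxl.
  - by move: y Gj; exact/subsetPset/ndG/leq_maxr.
move=> k; have [mF oF] := Foo k; have [mG oG] := Goo k; split.
  rewrite -[X in measurable X]setTI; apply: measurable_uncons => //.
  exact: measurableX.
rewrite /cons_measure /pushforward -comp_preimage.
rewrite (_ : uncons \o _ = id); last by apply/funext => z; exact: rV_consK.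
by rewrite product_measure1E// lte_mul_pinfty// ge0_fin_numE.
Qed.

HB.instance Definition _ := Measure_isSigmaFinite.Build _ _ _ cons_measure
  cons_measure_sigma_finite.

End cons_measure.

Fixpoint lebesgue_rV n : {sigma_finite_measure set 'rV[R]_n -> \bar R} :=
  if n is n'.+1 then cons_measure (lebesgue_rV n')
  else \d_(0 : 'rV[R]_0).

End lebesgue_rV.

Section smooth_functions.
Context {R : realType} {N : nat}.
Implicit Types (phi : 'rV[R]_N -> R) (Omega : set 'rV[R]_N).

Definition partial (i : 'I_N) phi : 'rV[R]_N -> R :=
  fun x => 'D_(delta_mx ord0 i) phi x.

Definition gradient phi : 'rV[R]_N -> 'rV[R]_N :=
  fun x => \row_i partial i phi x.

(* C^infty(R^N): all iterated partial derivatives exist and are continuous. *)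
Definition smooth phi := forall s : seq 'I_N,
  continuous (foldr partial phi s) /\
  forall (i : 'I_N) (x : 'rV[R]_N),
    derivable (foldr partial phi s) x (delta_mx ord0 i).

(* C_c^infty(Omega), the functions being extended by 0 outside Omega. *)
Definition test_function Omega phi :=
  [/\ smooth phi, compact (closure [set x | phi x != 0]) &
      closure [set x | phi x != 0] `<=` Omega].

(* The boundary is smooth when Omega is, near each boundary point, a strict
   sublevel set of a smooth function with nonvanishing gradient there. *)
Definition smooth_bounded_domain Omega :=
  [/\ open Omega, connected Omega, Omega !=set0, bounded_set Omega &
      forall x0, (closure Omega `\` Omega) x0 ->
        exists2 psi, smooth psi /\ gradient psi x0 != 0 &
          \forall x \near x0, Omega x <-> psi x < 0].

End smooth_functions.

Section sobolev.
Context {R : realType} {N : nat}.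
Variable Omega : set 'rV[R]_N.

Local Notation leb := (@lebesgue_rV R N).

(* A Sobolev function is a pair (representative, representative of its weak
   gradient); the gradient is determined a.e. in Omega by the function, and only
   the values in Omega matter.  Pairs are added and scaled componentwise. *)
Definition sobolev : Type := (('rV[R]_N -> R) * ('rV[R]_N -> 'rV[R]_N))%type.

HB.instance Definition _ := GRing.Lmodule.on sobolev.

Implicit Types (u v w : sobolev).

Definition L2 (g : 'rV[R]_N -> R) :=
  measurable_fun Omega g /\
  leb.-integrable Omega (fun x => (g x ^+ 2)%:E).

Definition L2dot u v : R := \int[leb]_(x in Omega) (u.1 x * v.1 x).

Definition H10dot u v : R :=
  \int[leb]_(x in Omega) (\sum_(i < N) u.2 x ord0 i * v.2 x ord0 i).

Definition L2norm u : R := Num.sqrt (L2dot u u).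

Definition H10norm u : R := Num.sqrt (H10dot u u).

Definition is_weak_gradient (g : 'rV[R]_N -> R) (G : 'rV[R]_N -> 'rV[R]_N) :=
  forall phi, test_function Omega phi -> forall i : 'I_N,
    \int[leb]_(x in Omega) (g x * partial i phi x) =
    - \int[leb]_(x in Omega) (G x ord0 i * phi x).

Definition H1 : set sobolev := [set u : sobolev |
  [/\ L2 u.1, (forall i : 'I_N, L2 (fun x => u.2 x ord0 i)) &
      is_weak_gradient u.1 u.2]].

(* H^1_0(Omega) is the closure of C_c^infty(Omega) in H^1(Omega). *)
Definition H10 : set sobolev := [set u : sobolev | H1 u /\
  exists2 phi : ('rV[R]_N -> R)^nat, (forall n, test_function Omega (phi n)) &
    let d n : sobolev := ((phi n, gradient (phi n)) : sobolev) - u in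
    (L2dot (d n) (d n) + H10dot (d n) (d n)) @[n --> \oo] --> (0 : R)].

Definition dirichlet_eigenvalue (l : R) := exists u,
  [/\ H10 u, L2dot u u != 0 &
      forall v, H10 v -> H10dot u v = l * L2dot u v].

Definition lambda1 : R := inf [set l | dirichlet_eigenvalue l].

(* <J'(u), v> = l, as a directional derivative; existence is part of the
   statement, so the default value of the library's derivative never occurs. *)
Definition is_deriv_at (J : sobolev -> R) u v (l : R) :=
  is_derive (0 : R) (1 : R) (fun t : R => J (u + t *: v)) l.

End sobolev.

Section problem.
Context {R : realType} {N : nat}.
Variables (Omega : set 'rV[R]_N) (f : R -> R).
Implicit Types (u v w : @sobolev R N).

Local Notation leb := (@lebesgue_rV R N).

Definition primitive (t : R) : R :=
  if 0 <= t then \int[lebesgue_measure]_(s in `[0, t]) f s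
  else - \int[lebesgue_measure]_(s in `[t, 0]) f s.

Definition energy u : R :=
  H10norm Omega u ^+ 2 / 2 - \int[leb]_(x in Omega) primitive (u.1 x).

Definition sphere (mu : R) : set sobolev :=
  [set u : sobolev | H10 Omega u /\ L2dot Omega u u = mu].

Definition Splus (mu : R) : set sobolev :=
  [set u : sobolev | sphere mu u /\ exists2 l : R, 0 <= l &
     forall v, H10 Omega v -> is_deriv_at energy u v (l * L2dot Omega u v)].

Definition Nplus (mu : R) : set sobolev :=
  [set u : sobolev | sphere mu u /\
     exists2 l : R, is_deriv_at energy u u l & 0 <= l].

(* Weak solutions of - Delta u = l u + f(u) with mass mu. *)
Definition solution (mu : R) u (l : R) :=
  sphere mu u /\ forall v, H10 Omega v ->
    H10dot Omega u v =
    l * L2dot Omega u v + \int[leb]_(x in Omega) (f (u.1 x) * v.1 x).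

(* The perturbation method.  The absolute value only matters for the two-sided
   derivative at s = 0. *)

Definition pert (r s : R) : R := `|s| `^ r / (1 - s).

Definition Uball (mu : R) : set sobolev :=
  [set u : sobolev | H10 Omega u /\ L2norm Omega u ^+ 2 < mu].

Definition energy_pert (r mu : R) u : R :=
  energy u - pert r (L2norm Omega u ^+ 2 / mu).

Definition mp_path (r mu : R) (g : R -> sobolev) :=
  [/\ forall t, t \in `[0, 1] -> Uball mu (g t),
      forall t, t \in `[0, 1] ->
        H10norm Omega (g s - g t) @[s --> within `[0, 1] (nbhs t)] --> (0 : R),
      g 0 = 0 & energy_pert r mu (g 1) < 0].

Definition is_path_max (r mu : R) (g : R -> sobolev) (m : R) :=
  (exists2 t, t \in `[0, 1] & energy_pert r mu (g t) = m) /\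
  forall t, t \in `[0, 1] -> energy_pert r mu (g t) <= m.

Definition mp_level (r mu : R) : \bar R :=
  ereal_inf [set m%:E | m in
    [set m | exists2 g, mp_path r mu g & is_path_max r mu g m]].

Definition mp_critical (r mu : R) u :=
  [/\ Uball mu u,
      forall v, H10 Omega v -> is_deriv_at (energy_pert r mu) u v 0 &
      (energy_pert r mu u)%:E = mp_level r mu].

Definition perturbation_limit (mu : R) u (l : R) :=
  exists (r0 : R) (ur : R -> sobolev) (rn : R^nat),
  [/\ 1 <= r0 /\ (forall r, r0 < r -> mp_critical r mu (ur r)),
      (forall n, r0 < rn n) /\ {homo rn : m n / (m <= n)%N >-> m <= n},
      rn n @[n --> \oo] --> +oo,
      H10norm Omega (ur (rn n) - u) @[n --> \oo] --> (0 : R) &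
      2 / mu * derive1 (pert (rn n)) (L2norm Omega (ur (rn n)) ^+ 2 / mu)
        @[n --> \oo] --> l].

Definition solution_obtained (mu : R) u (l : R) :=
  [/\ solution mu u l, 0 <= l <= lambda1 Omega & perturbation_limit mu u l].

Definition critical_exponent : \bar R :=
  if (3 <= N)%N then (2 * N%:R / (N%:R - 2))%:E else +oo%E.

Definition cond_f1 (p K2 Kp : R) :=
  [/\ 2 < p, (p%:E < critical_exponent)%E, 0 <= K2 < lambda1 Omega, 0 <= Kp &
      forall t, `|f t| <= K2 * `|t| + Kp * `|t| `^ (p - 1)].

Definition cond_f2 :=
  (forall t, 0 <= f t * t) /\
  forall s t, s != 0 -> t != 0 -> s <= t -> f s / `|s| <= f t / `|t|.

Definition cond_f3 :=
  (primitive t / t ^+ 2 @[t --> +oo] --> +oo) /\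
  (primitive t / t ^+ 2 @[t --> -oo] --> +oo).

Definition cond_f4 (q : R) :=
  2 < q /\ forall t, 0 <= q * primitive t <= f t * t.

Definition existence_threshold (mu0 : R) := 0 < mu0 /\
  forall mu, 0 < mu < mu0 ->
    exists u l, solution mu u l /\ 0 <= l <= lambda1 Omega.

(* C is an admissible Gagliardo-Nirenberg constant C_{p,N} on H^1_0(Omega). *)
Definition GN_constant (p C : R) :=
  let b := N%:R * (1 / 2 - 1 / p) in
  0 < C /\ forall u, H10 Omega u ->
    (\int[leb]_(x in Omega) (`|u.1 x| `^ p)%:E <=
     (C * L2norm Omega u `^ ((1 - b) * p) * H10norm Omega u `^ (b * p))%:E)%E.

(* mu^* is +oo when the denominator K_p C_{p,N} vanishes. *)
Definition mu_star (p K2 Kp C q : R) : \bar R :=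
  let l1 := lambda1 Omega in
  if Kp == 0 then +oo%E
  else if p <= 2 + 4 / N%:R then
    (((l1 - K2) / (Kp * C)) `^ (2 / (p - 2)) * l1 `^ (- (N%:R / 2)))%:E
  else
    (((l1 - K2) / (Kp * C)) `^ (2 / (p - 2)) *
     (q / (q - 2)) `^ (2 / (p - 2) - N%:R / 2) * l1 `^ (- (N%:R / 2)))%:E.

End problem.

(* Main.v *)
(* Let w be in N^+(mu).  By (f2), t |-> E(t w) is nondecreasing on [0, 1], so a
   path t |-> t t0 w with t0 < 1 close to 1 is admissible and shows c_r <= E(w).
   Since f_r <= f_r' / r and f_r'(|u_r|^2 / mu) stays bounded along the sequence,
   E(u_r) = c_r + f_r(|u_r|^2 / mu) <= E(w) + o(1); finally E(u) <= liminf E(u_r),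
   because the primitive of f is convex and H^1_0 embeds in L^p.  Hence
   E(u) <= inf over N^+(mu); moreover u is in S^+(mu), which is contained in N^+(mu).
   The embedding for p < 2^* is obtained from Gagliardo's inequality applied to
   (1 + phi^2)^(g/2) - 1, by absorbing a lower power of phi, and passes from test
   functions to H^1_0 by truncation. *)

Require Import Defs.
From mathcomp Require Import all_boot all_order all_algebra.
From mathcomp Require Import all_classical all_reals all_analysis.
From mathcomp Require Import measurable_realfun ring lra.
Import Order.TTheory GRing.Theory Num.Theory.
Import numFieldTopology.Exports numFieldNormedType.Exports.

Set Implicit Arguments.
Unset Strict Implicit.
Unset Printing Implicit Defensive.

Local Open Scope classical_set_scope.
Local Open Scope ring_scope.

(** * Gagliardo's inequality *)

(** The first alternative supplies no [L^p] bound, so the subcriticality in (f1) has to place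
    [H^1_0] in [L^p]; otherwise neither the integrals of [F(u)] and [f(u) v] nor the derivative of
    [E] along a line is under control. Gagliardo's inequality has the exponent [k = N / (N - 1)]
    ([2] when [N = 1]). With [g = p / k], its right-hand side involves the integral of
    [(1 + phi^2)^(g - 1)], while the left-hand side is comparable to that of [(1 + phi^2)^(p / 2)];
    [p < 2^*] says exactly that [g - 1 < p / 2], which makes the absorption possible. The
    lower-order terms are not homogeneous in [phi], so the gradient norm is first normalised to 1
    and the estimate is rescaled afterwards. Condition (f2) acts in two forms. Comparing [f(t a) a]
    with [t f(a) a] governs [E] along a ray. Monotonicity of [f] yields the convexity of [F], and
    also the dominating function needed to differentiate [E] under the integral sign. *)

Section ge0_hoelder_section.
Local Open Scope ereal_scope.
Context d (T : measurableType d) (R : realType) (m : {measure set T -> \bar R}).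
Implicit Types f g : T -> \bar R.

Lemma measurable_poweRT (f : T -> \bar R) (D : set T) (r : R) :
  measurable_fun D f -> measurable_fun D (fun x => f x `^ r).
Proof. by move=> mf; exact: (measurableT_comp (measurable_poweR r)). Qed.

Lemma ge0_integral_poweR_mul0 f g (t : R) : (0 < t)%R ->
  measurable_fun setT f -> measurable_fun setT g ->
  (forall x, 0 <= f x) -> \int[m]_x f x = 0 ->
  \int[m]_x (f x `^ t * g x) = 0.
Proof.
move=> t0 mf mg f0 If.
have f0' : ae_eq m setT f (cst 0).
  by apply/(ae_eq_integral_abs m measurableT mf); under eq_integral do rewrite gee0_abs//.
rewrite (ae_eq_integral (cst 0))//=; first by rewrite integral0.
  by apply: emeasurable_funM => //; exact: measurable_poweRT.
by apply: filterS f0' => x /= /(_ I) -> _; rewrite poweR0r ?gt_eqF// mul0e.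
Qed.

(** Extended values are needed because the induction on the dimension applies this to slice
    integrals, which may be infinite. If both integrals are finite, both functions are finite almost
    everywhere and the real inequality with exponents [1 / t] and [1 / (1 - t)] applies to their
    finite parts. *)
Lemma ge0_hoelder f g (t : R) : (0 < t < 1)%R ->
  measurable_fun setT f -> measurable_fun setT g ->
  (forall x, 0 <= f x) -> (forall x, 0 <= g x) ->
  \int[m]_x (f x `^ t * g x `^ (1 - t)) <=
    (\int[m]_x f x) `^ t * (\int[m]_x g x) `^ (1 - t).
Proof.
move=> /andP[t0 t1] mf mg f0 g0.
have t1' : (0 < 1 - t)%R by rewrite subr_gt0.
have RHS0 : 0 <= (\int[m]_x f x) `^ t * (\int[m]_x g x) `^ (1 - t).
  by rewrite mule_ge0// poweR_ge0.
have If0 : 0 <= \int[m]_x f x by exact: integral_ge0.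
have Ig0 : 0 <= \int[m]_x g x by exact: integral_ge0.
(* Zero integrals come before infinite ones: the right-hand side may be [0 * +oo], which is [0], so
   the left-hand side really has to vanish. *)
have [If|If] := eqVneq (\int[m]_x f x) 0.
  rewrite ge0_integral_poweR_mul0//.
  exact: measurable_poweRT.
have [Ig|Ig] := eqVneq (\int[m]_x g x) 0.
  under eq_integral do rewrite muleC.
  rewrite ge0_integral_poweR_mul0//.
  exact: measurable_poweRT.
have If' : 0 < \int[m]_x f x by rewrite lt0e If.
have Ig' : 0 < \int[m]_x g x by rewrite lt0e Ig.
have [Ify|Ify] := eqVneq (\int[m]_x f x) +oo.
  by rewrite Ify poweRyr ?gt_eqF// gt0_mulye ?leey// poweR_gt0.
have [Igy|Igy] := eqVneq (\int[m]_x g x) +oo.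
  by rewrite Igy poweRyr ?(gt_eqF t1')// gt0_muley ?leey// poweR_gt0.
have intf : m.-integrable setT f.
  by apply/integrableP; split => //; under eq_integral do rewrite gee0_abs//; rewrite ltey.
have intg : m.-integrable setT g.
  by apply/integrableP; split => //; under eq_integral do rewrite gee0_abs//; rewrite ltey.
have aef := integrable_ae measurableT intf.
have aeg := integrable_ae measurableT intg.
have mF : measurable_fun setT (fine \o f) by exact: measurableT_comp.
have mG : measurable_fun setT (fine \o g) by exact: measurableT_comp.
have F0 x : (0 <= fine (f x))%R by rewrite fine_ge0.
have G0 x : (0 <= fine (g x))%R by rewrite fine_ge0.
pose F x := (fine (f x) `^ t)%R; pose G x := (fine (g x) `^ (1 - t))%R.
have pq : (t^-1^-1 + (1 - t)^-1^-1 = 1)%R by rewrite !invrK addrC subrK.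
have mF' : measurable_fun setT F by apply: (measurableT_comp (measurable_powR _)).
have mG' : measurable_fun setT G by apply: (measurableT_comp (measurable_powR _)).
have := @hoelder _ T R m F G t^-1 (1 - t)^-1 mF' mG'.
rewrite !invr_gt0 => /(_ t0 t1' pq).
rewrite Lnorm1 unlock !invrK.
set L := \int[m]_x _; set L' := \int[m]_x (f x `^ _ * _).
suff -> : L = L'.
  move=> /le_trans; apply; rewrite le_eqVlt; apply/orP; left; apply/eqP.
  congr (_ `^ _ * _ `^ _).
    apply: ae_eq_integral => //.
      by apply: measurable_poweRT; apply: measurableT_comp => //; exact/measurable_EFinP.
    apply: filterS aef => x /= /(_ I) fx _.
    by rewrite ger0_norm ?powR_ge0// -powRrM mulfV ?gt_eqF// powRr1// fineK.
  apply: ae_eq_integral => //.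
    by apply: measurable_poweRT; apply: measurableT_comp => //; exact/measurable_EFinP.
  apply: filterS aeg => x /= /(_ I) fx _.
  by rewrite ger0_norm ?powR_ge0// -powRrM mulfV ?(gt_eqF t1')// powRr1// fineK.
apply: ae_eq_integral => //.
- apply: measurableT_comp => //; apply/measurable_EFinP; exact: measurable_funM.
- by apply: emeasurable_funM; exact: measurable_poweRT.
- apply: filterS2 aef aeg => x /= /(_ I) fx /(_ I) gx _.
  rewrite /F /G -!fine_poweR ger0_norm ?mulr_ge0 ?fine_ge0 ?poweR_ge0//.
  by rewrite EFinM !fineK// fin_num_poweR.
Qed.

End ge0_hoelder_section.

(** * Slicing Lebesgue measure along one coordinate *)

Section fubini_rV.
Local Open Scope ereal_scope.
Context {R : realType}.
Implicit Types n : nat.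

Lemma measurable_rV_cons_r n (s : R) :
  measurable_fun setT (fun y : 'rV[R]_n => rV_cons (s, y)).
Proof. by apply: (measurableT_comp (@measurable_rV_cons R n)); exact: pair1_measurable. Qed.

Lemma ge0_integral_rV_cons_prod n (F : 'rV[R]_n.+1 -> \bar R) :
  measurable_fun setT F -> (forall x, 0 <= F x) ->
  \int[lebesgue_rV n.+1]_x F x =
  \int[lebesgue_measure \x lebesgue_rV n]_z F (rV_cons z).
Proof.
move=> mF F0.
have mcons : @measurable_fun _ _ (measurableTypeR R * 'rV[R]_n)%type 'rV[R]_n.+1
  setT (@rV_cons R n) by exact: measurable_rV_cons.
pose nu : {measure set (measurableTypeR R * 'rV[R]_n) -> \bar R} :=
  (@lebesgue_measure R \x @lebesgue_rV R n).
have := ge0_integral_pushforward mcons nu measurableT mF (fun x _ => F0 x).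
rewrite preimage_setT => <-.
by apply: eq_measure_integral.
Qed.

Lemma ge0_integral_rV_cons n (F : 'rV[R]_n.+1 -> \bar R) :
  measurable_fun setT F -> (forall x, 0 <= F x) ->
  \int[lebesgue_rV n.+1]_x F x =
  \int[lebesgue_measure]_s \int[lebesgue_rV n]_y F (rV_cons (s, y)).
Proof.
move=> mF F0; rewrite ge0_integral_rV_cons_prod// fubini_tonelli1//.
by apply: measurableT_comp => //; exact: measurable_rV_cons.
Qed.

Lemma ge0_integral_rV_cons2 n (F : 'rV[R]_n.+1 -> \bar R) :
  measurable_fun setT F -> (forall x, 0 <= F x) ->
  \int[lebesgue_rV n.+1]_x F x =
  \int[lebesgue_rV n]_y \int[lebesgue_measure]_s F (rV_cons (s, y)).
Proof.
move=> mF F0; rewrite ge0_integral_rV_cons_prod// fubini_tonelli2//.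
by apply: measurableT_comp => //; exact: measurable_rV_cons.
Qed.

Lemma measurable_integral_rV_l n (F : 'rV[R]_n.+1 -> \bar R) :
  measurable_fun setT F -> (forall x, 0 <= F x) ->
  measurable_fun setT (fun s : R => \int[lebesgue_rV n]_y F (rV_cons (s, y))).
Proof.
move=> mF F0.
apply: (@measurable_fun_fubini_tonelli_F _ _ _ _ _ (lebesgue_rV n) (F \o @rV_cons R n)).
- by apply: measurableT_comp => //; exact: measurable_rV_cons.
- by move=> z; exact: F0.
Qed.

Lemma measurable_integral_rV_r n (F : 'rV[R]_n.+1 -> \bar R) :
  measurable_fun setT F -> (forall x, 0 <= F x) ->
  measurable_fun setT (fun y : 'rV[R]_n => \int[lebesgue_measure]_s F (rV_cons (s, y))).
Proof.
move=> mF F0.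
apply: (@measurable_fun_fubini_tonelli_G _ _ _ _ _ lebesgue_measure (F \o @rV_cons R n)).
- by apply: measurableT_comp => //; exact: measurable_rV_cons.
- by move=> z; exact: F0.
Qed.

Definition set_coord n (x : 'rV[R]_n) (i : 'I_n) (s : R) : 'rV[R]_n :=
  \row_j (if j == i then s else x ord0 j).

Lemma rV_cons0 n s (y : 'rV[R]_n) : rV_cons (s, y) ord0 ord0 = s.
Proof.
rewrite /rV_cons (_ : ord0 = @lshift 1 n ord0); last exact: val_inj.
by rewrite [LHS](row_mxEl _ y) mxE mulr1n.
Qed.

Lemma rV_consS n s (y : 'rV[R]_n) i : rV_cons (s, y) ord0 (lift ord0 i) = y ord0 i.
Proof.
rewrite /rV_cons (_ : lift ord0 i = @rshift 1 n i); last exact: val_inj.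
exact: (row_mxEr s%:M).
Qed.

Lemma set_coord_cons0 n s t (y : 'rV[R]_n) : set_coord (rV_cons (s, y)) ord0 t =
  rV_cons (t, y).
Proof.
apply/rowP => j; rewrite mxE; case: (unliftP ord0 j) => [k|] ->.
  by rewrite !rV_consS.
by rewrite eqxx rV_cons0.
Qed.

Lemma set_coord_consS n s t (y : 'rV[R]_n) i :
  set_coord (rV_cons (s, y)) (lift ord0 i) t = rV_cons (s, set_coord y i t).
Proof.
apply/rowP => j; rewrite mxE; case: (unliftP ord0 j) => [k|] ->.
  by rewrite !rV_consS mxE (inj_eq lift_inj).
by rewrite !rV_cons0.
Qed.

(* With the sum (rather than the geometric mean) of the integrals of the [h i]
   on the right, the induction on the dimension is linear in the slices. *)
Lemma gagliardo_weighted n (g phi : 'rV[R]_n.+1 -> \bar R) (h : 'I_n.+1 -> 'rV[R]_n.+1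
  -> \bar R) :
  measurable_fun setT g -> (forall x, 0 <= g x) ->
  measurable_fun setT phi -> (forall x, 0 <= phi x) ->
  (forall i, measurable_fun setT (h i)) -> (forall i x, 0 <= h i x) ->
  (forall i x, phi x <= \int[lebesgue_measure]_s h i (set_coord x i s)) ->
  \int[lebesgue_rV n.+1]_x (g x `^ n.+1%:R^-1 * phi x) <=
    (\int[lebesgue_rV n.+1]_x g x) `^ n.+1%:R^-1 *
    \sum_(i < n.+1) \int[lebesgue_rV n.+1]_x h i x.
Proof.
elim: n => [|n IH] in g phi h *.
  move=> mg g0 mphi phi0 mh h0 le_phi.
  rewrite big_ord_recl big_ord0 adde0 invr1 poweRe1 ?integral_ge0//.
  under eq_integral do rewrite poweRe1//.
  (* In dimension one the only line is the whole space, so [phi] is bounded by a constant. *)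
  have phiH x : phi x <= \int[lebesgue_rV 1]_y h ord0 y.
    rewrite ge0_integral_rV_cons2//= integral_dirac//=; last exact: measurable_integral_rV_r.
    rewrite diracT mul1e.
    have -> : x = rV_cons (x ord0 ord0, 0%R).
      by apply/rowP => i; rewrite ord1 rV_cons0.
    apply: le_trans (le_phi ord0 _) _.
    by under eq_integral do rewrite set_coord_cons0.
  rewrite -ge0_integralZr//; last exact: integral_ge0.
  apply: ge0_le_integral => //.
  - by move=> x _; rewrite mule_ge0.
  - exact: emeasurable_funM.
  - by apply: emeasurable_funM => //; exact: measurable_cst.
  - by move=> x _; apply: lee_pmul.
move=> mg g0 mphi phi0 mh h0 le_phi.
set N := n.+1 in IH *.
set A := \sum_(i < N.+1) _.
have A0 : 0 <= A by apply: sume_ge0 => i _; exact: integral_ge0.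
have N0 : (0 < N%:R :> R)%R by rewrite ltr0n.
have N10 : (0 < N.+1%:R :> R)%R by rewrite ltr0n.
pose t : R := (N.+1%:R^-1)%R.
have t01 : (0 < t < 1)%R by rewrite invr_gt0 N10 invf_lt1// ltr1n.
(* [k] is conjugate to the exponent [t] of the weight, as [k * (1 - t) = 1], and
   [phi ^ k = phi ^ (1 / N) * phi] has the shape of the induction hypothesis in dimension [N]. *)
pose k : R := (1 + N%:R^-1)%R.
have k0 : (0 < k)%R by rewrite addr_gt0// invr_gt0.
have kt : (k * (1 - t) = 1)%R.
  rewrite /k /t; field.
  by rewrite ?(gt_eqF N0) -?natr1 ?gt_eqF.
have Hphi : \int[lebesgue_rV N.+1]_x (phi x `^ k) <= A `^ k.
  rewrite ge0_integral_rV_cons//; last 2 first.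
    exact: measurable_poweRT.
    by move=> x; exact: poweR_ge0.
  pose g0' (y : 'rV[R]_N) := \int[lebesgue_measure]_s h ord0 (rV_cons (s, y)).
  have mg0' : measurable_fun setT g0' by exact: measurable_integral_rV_r.
  have g0'0 y : 0 <= g0' y by exact: integral_ge0.
  have Ig0' : \int[lebesgue_rV N]_y g0' y = \int[lebesgue_rV N.+1]_x h ord0 x.
    by rewrite ge0_integral_rV_cons2.
  (* On a slice, the factor [phi ^ (1 / N)] is bounded through the line in the first direction by
     [g0' ^ (1 / N)]. Since [g0'] does not depend on [s], it serves as the weight of the induction
     hypothesis, and what remains is linear in the slice. *)
  have slice s : \int[lebesgue_rV N]_y (phi (rV_cons (s, y)) `^ k) <=
     (\int[lebesgue_rV N]_y g0' y) `^ N%:R^-1 *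
     \sum_(i < N) \int[lebesgue_rV N]_y h (lift ord0 i) (rV_cons (s, y)).
    have mcons (f : 'rV[R]_N.+1 -> \bar R) : measurable_fun setT f ->
        measurable_fun setT (fun y => f (rV_cons (s, y))).
      by move=> mf; apply: (measurableT_comp mf); exact: measurable_rV_cons_r.
    apply: le_trans (IH g0' (fun y => phi (rV_cons (s, y)))
      (fun i y => h (lift ord0 i) (rV_cons (s, y))) _ _ _ _ _ _ _) => //.
    - apply: ge0_le_integral => //.
      + by move=> y _; exact: poweR_ge0.
      + by apply: measurable_poweRT; exact: mcons.
      + by apply: emeasurable_funM; [exact: measurable_poweRT|exact: mcons].
      + move=> y _; rewrite /k poweRD; last by apply: add_neq0_poweRD_def; rewrite gt_eqF.
        rewrite poweRe1// muleC; apply: lee_wpmul2r => //.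
        apply: gt0_ler_poweR; rewrite ?in_itv/= ?leey ?andbT ?invr_ge0//.
        by apply: le_trans (le_phi ord0 _) _; under eq_integral do rewrite set_coord_cons0.
    - exact: mcons.
    - by move=> i; exact: mcons.
    - by move=> i y; apply: le_trans (le_phi (lift ord0 i) _) _; under eq_integral do
      rewrite set_coord_consS.
  apply: (@le_trans _ _ (\int[lebesgue_measure]_s ((\int[lebesgue_rV N]_y g0' y) `^ N%:R^-1 *
     \sum_(i < N) \int[lebesgue_rV N]_y h (lift ord0 i) (rV_cons (s, y))))).
    apply: ge0_le_integral => //.
    - by move=> s _; apply: integral_ge0 => y _; exact: poweR_ge0.
    - apply: (@measurable_integral_rV_l _ (fun x => phi x `^ k)) => //; last by move=>
      x; exact: poweR_ge0.
      exact: measurable_poweRT.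
    - apply: emeasurable_funM => //.
      by apply: emeasurable_sum => i; exact: measurable_integral_rV_l.
  rewrite ge0_integralZl//; last 3 first.
  - by apply: emeasurable_sum => i; exact: measurable_integral_rV_l.
  - by move=> s _; apply: sume_ge0 => i _; exact: integral_ge0.
  - exact: poweR_ge0.
  rewrite ge0_integral_sum//; last 2 first.
  - by move=> i; exact: measurable_integral_rV_l.
  - by move=> i s _; exact: integral_ge0.
  under eq_bigr do rewrite -ge0_integral_rV_cons//.
  rewrite /k poweRD; last by apply: add_neq0_poweRD_def; rewrite gt_eqF.
  rewrite poweRe1// muleC Ig0'.
  (* The first term of [A] and the sum of the others are each at most [A]; this turns the product
     into [A * A ^ (1 / N)]. *)
  have -> : A = \int[lebesgue_rV N.+1]_x h ord0 x +
      \sum_(i < N) \int[lebesgue_rV N.+1]_x h (lift ord0 i) x.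
    by rewrite /A big_ord_recl.
  apply: lee_pmul => //.
- by apply: sume_ge0 => i _; exact: integral_ge0.
  - exact: poweR_ge0.
  - by rewrite leeDr// integral_ge0.
  - apply: gt0_ler_poweR; rewrite ?in_itv/= ?leey ?andbT ?invr_ge0//.
    + exact: integral_ge0.
    + by rewrite adde_ge0// ?integral_ge0// sume_ge0// => i _; exact: integral_ge0.
    + by rewrite leeDl// sume_ge0// => i _; exact: integral_ge0.
rewrite -/t.
(* Hölder's inequality now separates the weight [g] from [phi]. *)
have -> : \int[lebesgue_rV N.+1]_x (g x `^ t * phi x) =
          \int[lebesgue_rV N.+1]_x (g x `^ t * (phi x `^ k) `^ (1 - t)).
  by apply: eq_integral => x _; rewrite -poweRrM kt poweRe1.
apply: (le_trans (@ge0_hoelder _ _ _ (lebesgue_rV N.+1) g (fun x => phi x `^ k) t t01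
  mg _ g0 _)).
- exact: measurable_poweRT.
- by move=> x; exact: poweR_ge0.
rewrite lee_wpmul2l ?poweR_ge0//.
have -> : A = (A `^ k) `^ (1 - t) by rewrite -poweRrM kt poweRe1.
case/andP: t01 => t0 t1.
apply: gt0_ler_poweR; rewrite ?in_itv/= ?leey ?andbT ?subr_ge0 ?poweR_ge0//.
  exact: ltW.
by apply: integral_ge0 => x _; exact: poweR_ge0.
Qed.

End fubini_rV.

(** * Open sets and bounded sets for the coordinate sigma-algebra *)

Section rV_measure.
Context {R : realType}.
Implicit Types n : nat.

Lemma measurable_forall_coord n (P : 'I_n -> set R) :
  (forall i, measurable (P i)) ->
  measurable [set y : 'rV[R]_n | forall i, P i (y ord0 i)].
Proof.
move=> mP.
have -> : [set y : 'rV[R]_n | forall i, P i (y ord0 i)] =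
    \bigcap_(i in [set: 'I_n]) ((fun y : 'rV[R]_n => y ord0 i) @^-1` P i).
  apply/seteqP; split => [y Py i _|y Py i]; first exact: Py.
  exact: (Py i).
apply: fin_bigcap_measurable => // i _.
rewrite -[X in measurable X]setTI.
exact: (@measurable_coord R n i measurableT).
Qed.

(** Balls are boxes, since the norm is the sup norm; so an open set is the union of the boxes with
    rational centre and radius [1 / (k + 1)] that it contains, and [unpickle] enumerates the pairs
    of a centre and a [k]. *)
Lemma open_measurable_rV n (A : set 'rV[R]_n) : open A -> measurable A.
Proof.
move=> oA.
pose box (q : 'rV[rat]_n * nat) : set 'rV[R]_n :=
  [set y | forall i, ball (ratr (q.1 ord0 i) : R) (q.2.+1%:R^-1) (y ord0 i)].
have mbox q : measurable (box q).
  by apply: (@measurable_forall_coord n (fun i => ball (ratr (q.1 ord0 i) : R)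
    (q.2.+1%:R^-1))) => i; exact: measurable_ball.
pose F k := if unpickle k is Some q then
  (if `[< box q `<=` A >] then box q else set0) else set0.
have -> : A = \bigcup_k F k.
  apply/seteqP; split => [x Ax|x [k _]]; last first.
    by rewrite /F; case: unpickle => // q; case: ifPn => // /asboolP; exact.
  have /nbhs_ballP[e /= e0 xeA] := open_nbhs_nbhs (conj oA Ax).
  have [k ke] : exists k, k.+1%:R^-1 < e / 2.
    exists (Num.truncn (e / 2)^-1); rewrite invf_plt ?posrE ?divr_gt0//.
    by rewrite truncnS_gt.
  have /choice[q qx] (i : 'I_n) : exists q : rat, ball (ratr q : R) (k.+1%:R^-1) (x ord0 i).
    have xk : x ord0 i - k.+1%:R^-1 < x ord0 i + k.+1%:R^-1.
      by rewrite ltrD2l gt0_cp// invr_gt0.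
    have [q] := rat_in_itvoo xk; rewrite in_itv/= => /andP[q1 q2].
    exists q; rewrite /ball/= ltr_norml; apply/andP.
    by rewrite ltrBrDl !ltrBlDl -ltrBlDl.
  pose Q : 'rV[rat]_n * nat := (\row_i q i, k).
  exists (pickle Q) => //; rewrite /F pickleK.
  have QA : box Q `<=` A.
    move=> y Qy; apply: xeA; split => // i j; rewrite ord1.
    apply: (@ball_splitr _ _ (ratr (q j) : R)).
      by apply: le_ball (qx j); exact: ltW.
    by apply: le_ball (ltW ke) _ _; have := Qy j; rewrite /= mxE.
  by rewrite asboolT// => i; rewrite /= mxE; exact: qx.
apply: bigcupT_measurable => k; rewrite /F.
by case: unpickle => // q; case: ifP.
Qed.

Lemma continuous_measurable_rV n (phi : 'rV[R]_n -> R) :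
  continuous phi -> measurable_fun setT phi.
Proof.
move=> cphi; apply: (@measurability _ _ _ R setT phi (@RGenOpens.G R)); first exact:
  RGenOpens.measurableE.
move=> _ [_ [a [b ->]] <-]; rewrite setTI; apply: open_measurable_rV.
by apply: open_comp => // x _; exact: cphi.
Qed.

Lemma lebesgue_rV_box n (M : R) :
  (lebesgue_rV n [set y : 'rV[R]_n | forall i, (y ord0 i \in `[- M, M])%R] < +oo)%E.
Proof.
elim: n => [|n IH].
  by rewrite /= diracE; case: (_ \in _); rewrite ltry.
rewrite /= /cons_measure /pushforward.
have mB m : measurable [set y : 'rV[R]_m | forall i, y ord0 i \in `[- M, M]].
  exact: (@measurable_forall_coord m (fun i => `[- M, M]%classic)).
rewrite (_ : _ @^-1` _ = `[- M, M]%classic `*` [set y : 'rV[R]_n | forall i, y ord0 i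
  \in `[- M, M]]).
  rewrite product_measure1E//.
  rewrite lte_mul_pinfty//.
  rewrite [X in X \is a _](_ : _ = lebesgue_measure `[- M, M]%classic)//.
  by rewrite lebesgue_measure_itv/=; case: ifP.
  exact: mB.
apply/seteqP; split => [[s y] /= H|[s y] /= [Hs Hy] i].
  split; first by have := H ord0; rewrite rV_cons0.
  by move=> i; have := H (lift ord0 i); rewrite rV_consS.
by case: (unliftP ord0 i) => [k|] ->; rewrite ?rV_consS ?rV_cons0.
Qed.

Lemma le_coord_norm n (x : 'rV[R]_n) i : `|x ord0 i| <= `|x|.
Proof.
rewrite [leRHS]/Num.norm /= mx_normrE; apply/bigmax_geP; right => /=.
by exists (ord0, i).
Qed.

Lemma bounded_rV_box n (A : set 'rV[R]_n) : bounded_set A ->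
  exists M, 0 < M /\ A `<=` [set y : 'rV[R]_n | forall i, (y ord0 i \in `[- M, M])%R].
Proof.
move=> /ex_strict_bound_gt0[M M0 AM]; exists M; split => // x Ax i.
rewrite in_itv/= -ler_norml; apply: le_trans (le_coord_norm _ _) _.
by apply: ltW; exact: AM.
Qed.

Lemma bounded_lebesgue_rV_lty n (A : set 'rV[R]_n) :
  measurable A -> bounded_set A -> (lebesgue_rV n A < +oo)%E.
Proof.
move=> mA /bounded_rV_box[M [M0 AM]].
apply: le_lt_trans (lebesgue_rV_box n M).
apply: le_measure; rewrite ?inE//.
exact: (@measurable_forall_coord n (fun i => `[- M, M]%classic)).
Qed.

End rV_measure.

(** * Test functions *)

Section test_functions.
Context {R : realType} {N : nat}.
Implicit Types (phi psi : 'rV[R]_N -> R) (Omega : set 'rV[R]_N).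

(** The combination [phi + c *: psi] serves at once for sums, for differences ([c = -1]) and for
    multiples ([phi + (c - 1) *: phi]), here and later for Sobolev pairs. *)
Lemma partialD phi psi (c : R) i :
  (forall x, derivable phi x (delta_mx ord0 i)) ->
  (forall x, derivable psi x (delta_mx ord0 i)) ->
  partial i (phi + c *: psi) = partial i phi + c *: partial i psi.
Proof.
move=> dphi dpsi; apply/funext => x; rewrite /partial.
have -> : 'D_(delta_mx ord0 i) (phi + c *: psi) x =
  'D_(delta_mx ord0 i) phi x + 'D_(delta_mx ord0 i) (c *: psi) x.
  by apply: deriveD => //; apply: derivableZ.
by rewrite deriveZ.
Qed.

Lemma smooth_foldrD phi psi (c : R) (s : seq 'I_N) : smooth phi -> smooth psi ->
  foldr partial (phi + c *: psi) s = foldr partial phi s + c *: foldr partial psi s.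
Proof.
move=> sphi spsi; elim: s => [//|i s IH] /=; rewrite IH partialD//.
  by move=> x; exact: (sphi s).2.
by move=> x; exact: (spsi s).2.
Qed.

Lemma smoothD phi psi (c : R) : smooth phi -> smooth psi -> smooth (phi + c *: psi).
Proof.
move=> sphi spsi s; rewrite (smooth_foldrD c s sphi spsi); split => [x|i x].
  apply: continuousD; first exact: (sphi s).1.
  by apply: continuousZl_tmp; exact: (spsi s).1.
by apply: derivableD; [exact: (sphi s).2|apply: derivableZ; exact: (spsi s).2].
Qed.

Lemma smooth_continuous phi : smooth phi -> continuous phi.
Proof. by move=> /(_ [::])[]. Qed.

Lemma smooth_derivable phi x i : smooth phi -> derivable phi x (delta_mx ord0 i).
Proof. by move=> /(_ [::])[_]; exact. Qed.

Lemma smooth_partial_continuous phi i : smooth phi -> continuous (partial i phi).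
Proof. by move=> /(_ [:: i])[]. Qed.

Lemma gradientD phi psi (c : R) : smooth phi -> smooth psi ->
  gradient (phi + c *: psi) = gradient phi + c *: gradient psi.
Proof.
move=> sphi spsi; apply/funext => x; apply/rowP => i; rewrite !mxE.
rewrite partialD//; last by move=> y; exact: smooth_derivable.
by move=> y; exact: smooth_derivable.
Qed.

Lemma test_functionD Omega phi psi (c : R) :
  test_function Omega phi -> test_function Omega psi ->
  test_function Omega (phi + c *: psi).
Proof.
move=> [sphi kphi phiO] [spsi kpsi psiO].
have sub : closure [set x | (phi + c *: psi) x != 0] `<=`
    closure [set x | phi x != 0] `|` closure [set x | psi x != 0].
  rewrite -closureU; apply: closure_subset => x /=.
  have [phi0|] := eqVneq (phi x) 0; last by left.
  have [psi0|] := eqVneq (psi x) 0; last by right.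
  by rewrite !fctE phi0 psi0 scaler0 addr0 eqxx.
split; first exact: smoothD.
- apply: subclosed_compact sub; first exact: closed_closure.
  exact: compactU.
- by move=> x /sub[/phiO|/psiO].
Qed.

Lemma test_function_out Omega phi x : test_function Omega phi -> ~ Omega x -> phi x = 0.
Proof.
move=> [_ _ phiO] nOx; apply/eqP; apply: contra_notT nOx => phix.
by apply: phiO; exact: subset_closure.
Qed.

Lemma partial_out phi i x : ~ closure [set y | phi y != 0] x -> partial i phi x = 0.
Proof.
move=> nx; have nbx : \forall y \near x, phi y = 0.
  have : nbhs x (~` closure [set y | phi y != 0]).
    apply: open_nbhs_nbhs; split => //; rewrite openC; exact: closed_closure.
  apply: filterS => y ny; apply/eqP; apply: contra_notT ny => yy.
  exact: subset_closure.
rewrite /partial.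
have -> : 'D_(delta_mx ord0 i) phi x = 'D_(delta_mx ord0 i) (cst 0) x.
  by apply: near_eq_derive; rewrite ?delta_mx_neq0//; near=> y; rewrite (near nbx).
by rewrite derive_cst.
Unshelve. all: by end_near. Qed.

Lemma test_partial_out Omega phi i x : test_function Omega phi -> ~ Omega x ->
  partial i phi x = 0.
Proof. by move=> [_ _ phiO] nOx; apply: partial_out => /phiO. Qed.

Lemma compact_support_bounded phi (K : set 'rV[R]_N) : continuous phi -> compact K ->
  (forall x, ~ K x -> phi x = 0) -> exists2 B, 0 < B & forall x, `|phi x| <= B.
Proof.
move=> cphi cK phi0.
have : compact (phi @` K).
  by apply: continuous_compact => //; exact: continuous_subspaceT.
move=> /compact_bounded /ex_strict_bound_gt0[B B0 KB]; exists B => // x.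
have [Kx|nKx] := pselect (K x); last by rewrite phi0// normr0 ltW.
by apply: ltW; apply: KB; exists x.
Qed.

Lemma test_bounded Omega phi : test_function Omega phi ->
  exists2 B, 0 < B & forall x, `|phi x| <= B.
Proof.
move=> [sphi kphi _]; apply: (compact_support_bounded (smooth_continuous sphi) kphi).
by move=> x nx; apply/eqP; apply: contra_notT nx => xx; exact: subset_closure.
Qed.

Lemma test_partial_bounded Omega phi i : test_function Omega phi ->
  exists2 B, 0 < B & forall x, `|partial i phi x| <= B.
Proof.
move=> [sphi kphi _].
apply: (compact_support_bounded (smooth_partial_continuous (i := i) sphi) kphi).
by move=> x nx; exact: partial_out.
Qed.

Lemma set_coord_id (x : 'rV[R]_N) i : set_coord x i (x ord0 i) = x.
Proof. by apply/rowP => j; rewrite mxE; case: (eqVneq j i) => [->|]. Qed.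

Lemma set_coordD (x : 'rV[R]_N) i (s h : R) :
  set_coord x i (h + s) = h *: delta_mx ord0 i + set_coord x i s.
Proof.
apply/rowP => j; rewrite !mxE eqxx/=; case: (eqVneq j i) => _ /=.
  by rewrite mulr1.
by rewrite mulr0 add0r.
Qed.

Lemma is_derive_set_coord phi (x : 'rV[R]_N) i (s : R) :
  derivable phi (set_coord x i s) (delta_mx ord0 i) ->
  is_derive s 1 (fun t : R => phi (set_coord x i t)) (partial i phi (set_coord x i s)).
Proof.
move=> dphi.
have E : (fun h : R => h^-1 *: ((phi \o set_coord x i) (h *: 1 + s) - phi (set_coord x i s))) =
         (fun h : R => h^-1 *: ((phi \o shift (set_coord x i s)) (h *: delta_mx ord0 i)
           - phi (set_coord x i s))).
  apply/funext => h /=; congr (_ *: (_ - _)).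
  by rewrite -set_coordD scaler1.
apply: DeriveDef.
  by rewrite /derivable/= [X in cvg (X @ _)]E.
by rewrite /derive/= [X in lim (X @ _)]E.
Qed.

Lemma continuous_set_coord (x : 'rV[R]_N) i : continuous (set_coord x i : R -> 'rV[R]_N).
Proof.
move=> s; apply/cvg_ballP => e e0.
have : \forall t \near s, ball s e t by exact: nbhsx_ballx.
apply: filterS => t st; split => // a b.
by rewrite ord1 !mxE; case: (eqVneq b i) => _ //; exact: ballxx.
Qed.

End test_functions.

(** * The Sobolev inequality for test functions *)

Section real_inequalities.
Context {R : realType}.
Implicit Types a b e p t : R.

Lemma powR_le_eps_powR a b e : 0 <= a -> a < b -> 0 < e ->
  exists2 C, 0 <= C & forall t, 0 <= t -> t `^ a <= e * t `^ b + C.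
Proof.
move=> a0 ab e0; have ba : 0 < b - a by rewrite subr_gt0.
(* Above the threshold [T] one has [t ^ (b - a) >= 1 / e], so the first term suffices; below it,
   [T ^ a] does. *)
pose T : R := e^-1 `^ (b - a)^-1; have T0 : 0 < T by rewrite powR_gt0// invr_gt0.
exists (T `^ a) => [|t t0]; first exact: powR_ge0.
have [tT|Tt] := leP t T.
  by apply: ler_wpDl; [rewrite mulr_ge0 ?powR_ge0// ltW|rewrite ge0_ler_powR// nnegrE// ltW].
apply: ler_wpDr; first exact: powR_ge0.
have t0' : 0 < t by rewrite (lt_trans T0).
have -> : t `^ b = t `^ (b - a) * t `^ a by rewrite -powRD ?subrK// (gt_eqF t0') implybT.
rewrite mulrA ler_peMl ?powR_ge0// -ler_pdivrMl// mulr1.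
have -> : e^-1 = T `^ (b - a) by rewrite /T -powRrM mulVf ?gt_eqF// powRr1// invr_ge0 ltW.
by rewrite ge0_ler_powR ?nnegrE// ltW.
Qed.

Lemma powRD_le a b p : 0 <= a -> 0 <= b -> 0 <= p ->
  (a + b) `^ p <= 2 `^ p * (a `^ p + b `^ p).
Proof.
move=> a0 b0 p0; rewrite mulrDr -!powRM//.
have [ab|ba] := leP a b.
  apply: ler_wpDl; first exact: powR_ge0.
  rewrite ge0_ler_powR ?nnegrE ?addr_ge0 ?mulr_ge0//; lra.
apply: ler_wpDr; first exact: powR_ge0.
rewrite ge0_ler_powR ?nnegrE ?addr_ge0 ?mulr_ge0//; lra.
Qed.

Lemma powR_le_1D2 a t : 0 <= a <= 2 -> 0 <= t -> t `^ a <= 1 + t ^+ 2.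
Proof.
move=> /andP[a0 a2] t0; have [t1|t1] := leP t 1.
  apply: (@le_trans _ _ 1); last by rewrite lerDl sqr_ge0.
  have /= <- := congr1 (fun g => g a) (@powR1 R).
  by rewrite ge0_ler_powR ?nnegrE.
rewrite ler_wpDl// -powR_mulrn// ler_powR// ltW//.
Qed.

Lemma le_integral_derive_abs (k k' h : R -> R) (a b : R) : a < b ->
  (forall s : R, is_derive s (1 : R) k (k' s)) -> continuous k' ->
  measurable_fun setT h -> (forall s, `|k' s| <= h s) ->
  ((k b - k a)%:E <= \int[lebesgue_measure]_s (h s)%:E)%E.
Proof.
move=> ab dk ck' mh kh.
have h0 s : 0 <= h s by apply: le_trans (kh s).
have ck : continuous k.
  move=> s; apply: differentiable_continuous; apply/derivable1_diffP.
  by have [] := dk s.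
have mk' : measurable_fun `[a, b] k'.
  apply: subspace_continuous_measurable_fun => //; exact: continuous_subspaceT.
have ck'ab : {within `[a, b], continuous k'} by exact: continuous_subspaceT.
have Fk : derivable_oo_LRcontinuous k a b.
  split; first by move=> s _; have [] := dk s.
    by apply: cvg_at_right_filter; exact: ck.
  by apply: cvg_at_left_filter; exact: ck.
have kk' : {in `]a, b[, derive1 k =1 k'}.
  by move=> s _; rewrite derive1E; have [_ ->] := dk s.
have FTC := continuous_FTC2 ab ck'ab Fk kk'.
rewrite EFinB -FTC.
apply: (le_trans (lee_abs _)).
apply: (le_trans (le_abse_integral _ _ _)) => //; first exact/measurable_EFinP.
apply: (@le_trans _ _ (\int[lebesgue_measure]_(s in `[a, b]) (h s)%:E)%E).
  apply: ge0_le_integral => //.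
  - by apply: measurableT_comp => //; exact/measurable_EFinP.
  - by apply/measurable_EFinP; exact: measurable_funTS.
  - by move=> s _; rewrite lee_fin.
apply: ge0_subset_integral => //.
  exact/measurable_EFinP.
by move=> s _; rewrite lee_fin.
Qed.

End real_inequalities.

Section line.
Context {R : realType}.

Lemma is_derive_bracket (r y : R) :
  is_derive y (1 : R) (fun z : R => (1 + z ^+ 2) `^ r) (r * (1 + y ^+ 2) `^ (r - 1) * (2 * y)).
Proof.
have dg : is_derive y (1 : R) (fun z : R => 1 + z ^+ 2) (2 * y).
  have -> : (fun z : R => 1 + z ^+ 2) = cst 1 + id * id.
    by apply/funext => z; rewrite expr2.
  apply: (is_derive_eq (is_deriveD (is_derive_cst (1 : R) y 1) (is_deriveM
    (is_derive_id y 1) (is_derive_id y 1)))).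
  by rewrite /GRing.scale/= mulr1 add0r -mulr2n mulr_natl.
apply: (@is_derive1_comp R (fun t => t `^ r) _ y _ _ _ dg).
by apply: is_derive1_powR; rewrite ltr_pwDl// sqr_ge0.
Qed.

Context {N : nat}.
Implicit Types (phi : 'rV[R]_N -> R) (Omega : set 'rV[R]_N).

(* [bracket phi ^ (g / 2) - 1] is a smooth substitute for [|phi| ^ g], which need
   not be differentiable where [phi] vanishes. *)
Definition bracket phi (x : 'rV[R]_N) : R := 1 + phi x ^+ 2.

Lemma bracket_ge1 phi x : 1 <= bracket phi x. Proof. by rewrite lerDl sqr_ge0. Qed.

Lemma bracket_gt0 phi x : 0 < bracket phi x. Proof. exact: lt_le_trans (bracket_ge1 _ _). Qed.

Lemma bracket_ge0 phi x : 0 <= bracket phi x. Proof. exact: ltW (bracket_gt0 _ _). Qed.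

Lemma norm_le_bracket phi x : `|phi x| <= bracket phi x `^ 2^-1.
Proof.
rewrite powR12_sqrt ?bracket_ge0// -sqrtr_sqr ler_sqrt ?bracket_ge0//.
by rewrite lerDr.
Qed.

Lemma bracket_powR_ge1 phi x r : 0 <= r -> 1 <= bracket phi x `^ r.
Proof.
move=> r0; have /= <- := congr1 (fun g => g r) (@powR1 R).
by rewrite ge0_ler_powR ?nnegrE ?bracket_ge0 ?bracket_ge1.
Qed.

Lemma continuous_bracket phi r : continuous phi -> continuous (fun x => bracket phi x `^ r).
Proof.
move=> cphi x; apply: (@continuous_comp _ _ _ phi (fun z : R => (1 + z ^+ 2) `^ r)).
  exact: cphi.
apply: differentiable_continuous; apply/derivable1_diffP.
by have [] := is_derive_bracket r (phi x).
Qed.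

(** Subtracting 1 makes [bracket phi ^ (g / 2) - 1] vanish outside [Omega], so it is the integral of
    its derivative along the line, started at the coordinate [- (M + 1)], outside a box that
    contains [Omega]. The derivative carries [bracket phi ^ (g / 2 - 1) * phi], and
    [norm_le_bracket] turns the factor [phi] into half a power of the bracket. *)
Lemma test_line_bound Omega phi (g : R) (x : 'rV[R]_N) i :
  bounded_set Omega -> test_function Omega phi -> 1 <= g ->
  ((bracket phi x `^ (g / 2) - 1)%:E <=
   \int[lebesgue_measure]_s
     (g * bracket phi (set_coord x i s) `^ ((g - 1) / 2) * `|partial i phi (set_coord x
       i s)|)%:E)%E.
Proof.
move=> /bounded_rV_box[M [M0 OM]] tphi g1.
have sphi : smooth phi by case: tphi.
have g0 : 0 < g by exact: lt_le_trans g1.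
have [Ox|nOx] := pselect (Omega x); last first.
  rewrite /bracket (test_function_out tphi nOx) expr0n/= addr0.
  rewrite powR1/= subrr; apply: integral_ge0 => s _.
  by rewrite lee_fin !mulr_ge0 ?powR_ge0// ltW.
pose k s := bracket phi (set_coord x i s) `^ (g / 2) - 1.
pose k' s := g / 2 * bracket phi (set_coord x i s) `^ (g / 2 - 1) * (2 * phi (set_coord
  x i s)) *
  partial i phi (set_coord x i s).
have xiM : x ord0 i \in `[- M, M] by exact: OM.
have ab : - (M + 1) < x ord0 i by move: xiM; rewrite in_itv/= => /andP[]; lra.
have := @le_integral_derive_abs R k k' (fun s => g * bracket phi (set_coord x i s) `^
  ((g - 1) / 2) *
  `|partial i phi (set_coord x i s)|) _ _ ab.
have -> : k (x ord0 i) = bracket phi x `^ (g / 2) - 1 by rewrite /k set_coord_id.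
have -> : k (- (M + 1)) = 0.
  rewrite /k /bracket (_ : phi _ = 0) ?expr0n/= ?addr0 ?powR1 ?subrr//.
  apply: (test_function_out tphi) => /OM /(_ i); rewrite mxE eqxx in_itv/= => /andP[]; lra.
rewrite subr0; apply.
- move=> s; rewrite /k /k'.
  have dq : is_derive s (1 : R) (fun t : R => phi (set_coord x i t)) (partial i phi
    (set_coord x i s)).
    by apply: is_derive_set_coord; exact: smooth_derivable.
  have dj := is_derive_bracket (g / 2) (phi (set_coord x i s)).
  have dc := @is_derive1_comp R _ _ s _ _ dj dq.
  have -> : (fun s0 : R => bracket phi (set_coord x i s0) `^ (g / 2) - 1) =
    ((fun z : R => (1 + z ^+ 2) `^ (g / 2)) \o (fun t : R => phi (set_coord x i t))) +
      cst (- 1) by [].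
  by apply: is_derive_eq; rewrite subr0.
- have cu : continuous (fun s : R => set_coord x i s) by exact: continuous_set_coord.
  have cphi : continuous phi by exact: smooth_continuous.
  move=> s; rewrite /k'.
  have c1 : {for s, continuous (fun s0 : R => bracket phi (set_coord x i s0) `^ (g / 2 - 1))}.
    apply: (@continuous_comp _ _ _ (fun s => set_coord x i s) (fun y => bracket phi y
      `^ (g / 2 - 1))); first exact: cu.
    exact: continuous_bracket.
  have c2 : {for s, continuous (fun s0 : R => phi (set_coord x i s0))}.
    by apply: (@continuous_comp _ _ _ (fun s => set_coord x i s) phi); [exact: cu|exact: cphi].
  have c3 : {for s, continuous (fun s0 : R => partial i phi (set_coord x i s0))}.
    apply: (@continuous_comp _ _ _ (fun s => set_coord x i s) (partial i phi)); first
      exact: cu.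
    exact: smooth_partial_continuous.
  apply: continuousM c3.
  apply: continuousM; first by apply: continuousM => //; exact: cvg_cst.
  by apply: continuousM => //; exact: cvg_cst.
- have cu : continuous (fun s : R => set_coord x i s) by exact: continuous_set_coord.
  have mcomp (f : 'rV[R]_N -> R) : continuous f -> measurable_fun setT (fun s : R => f
    (set_coord x i s)).
    move=> cf; apply: continuous_measurable_fun => s.
    by apply: (@continuous_comp _ _ _ (fun s => set_coord x i s) f); [exact: cu|exact: cf].
  apply: measurable_funM.
    apply: measurable_funM => //; apply: (mcomp (fun y => bracket phi y `^ ((g - 1) / 2))).
    by apply: continuous_bracket; exact: smooth_continuous.
  apply: measurableT_comp => //; apply: mcomp; exact: smooth_partial_continuous.
- move=> s; rewrite /k' normrM ler_wpM2r//.
  rewrite !normrM (ger0_norm (powR_ge0 _ _)) (gtr0_norm g0) (@ger0_norm _ 2)//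
    (@ger0_norm _ 2^-1)//.
  set W := bracket phi _.
  have -> : g / 2 * W `^ (g / 2 - 1) * (2 * `|phi (set_coord x i s)|) = g * (W `^ (g /
    2 - 1) * `|phi (set_coord x i s)|) by field.
  rewrite ler_pM2l//.
  have -> : (g - 1) / 2 = (g / 2 - 1) + 2^-1 by field.
  rewrite [leRHS]powRD; last by rewrite (gt_eqF (bracket_gt0 _ _)) implybT.
  apply: ler_wpM2l; [exact: powR_ge0|exact: norm_le_bracket].
Qed.

End line.

(** * Gagliardo's inequality with a single exponent *)

Section gagliardo_section.
Context {R : realType}.

Lemma integrable_bounded_fun d (T : measurableType d) (m : {measure set T -> \bar R})
    (D : set T) (f : T -> R) (B : R) :
  measurable D -> (m D < +oo)%E -> measurable_fun D f -> (forall x, D x -> `|f x| <= B) ->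
  m.-integrable D (EFin \o f).
Proof.
move=> mD finD mf fB; apply: measurable_bounded_integrable => //.
exists B; split; first exact: num_real.
by move=> M BM x Dx; apply: le_trans (fB x Dx) (ltW BM).
Qed.

Lemma integral_out_eq n (Omega : set 'rV[R]_n) (f : 'rV[R]_n -> R) :
  (forall x, ~ Omega x -> f x = 0) ->
  (\int[lebesgue_rV n]_x (f x)%:E = \int[lebesgue_rV n]_(x in Omega) (f x)%:E)%E.
Proof.
move=> f0; rewrite [RHS]integral_mkcond; apply: eq_integral => x _.
rewrite patchE; case: ifPn => // nx; rewrite f0//.
by move=> Ox; apply: (negP nx); rewrite inE.
Qed.

(** [k] is the exponent [N / (N - 1)] of the embedding of [W^{1,1}]. For [N = 1] that exponent would
    be infinite; [k = 2] is taken instead, at the price of a constant [D] equal to the measure of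
    [Omega]. The third clause is the form in which subcriticality of [p] is used later. *)
Lemma gagliardo n (Omega : set 'rV[R]_n.+1) :
  measurable Omega -> (lebesgue_rV n.+1 Omega < +oo)%E ->
  exists k D : R, [/\ 1 < k <= 2, 0 <= D,
    forall p : R, (p%:E < @critical_exponent R n.+1)%E -> p * (2 / k - 1) < 2 &
    forall (psi : 'rV[R]_n.+1 -> R) (h : 'I_n.+1 -> 'rV[R]_n.+1 -> R) (A B : R),
      measurable_fun setT psi -> (forall x, 0 <= psi x <= B) ->
      (forall x, ~ Omega x -> psi x = 0) ->
      (forall i, measurable_fun setT (h i)) -> (forall i x, 0 <= h i x) ->
      (forall i x, ((psi x)%:E <= \int[lebesgue_measure]_s (h i (set_coord x i s))%:E)%E) ->
      0 <= A -> (\sum_(i < n.+1) \int[lebesgue_rV n.+1]_x (h i x)%:E <= A%:E)%E ->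
      (\int[lebesgue_rV n.+1]_x (psi x `^ k)%:E <= (D * A `^ k)%:E)%E].
Proof.
move=> mO finO; case: n Omega mO finO => [|n] Omega mO finO.
  exists 2, (fine (lebesgue_rV 1 Omega)).
  split; [by lra|exact: fine_ge0| by move=> p _; rewrite divff ?subrr ?mulr0 |].
  move=> psi h A B mpsi psi0B psi0 mh h0 line A0 hA.
  have p0 x : 0 <= psi x by case/andP: (psi0B x).
  have G (g : 'rV[R]_1 -> R) : measurable_fun setT g -> (forall x, 0 <= g x) ->
     (\int[lebesgue_rV 1]_x (g x * psi x)%:E <= (\int[lebesgue_rV 1]_x (g x)%:E) * A%:E)%E.
    move=> mg g0.
    have := @gagliardo_weighted R 0 (EFin \o g) (EFin \o psi) (fun i => EFin \o h i).
    rewrite invr1 poweRe1; last by apply: integral_ge0 => x _; rewrite lee_fin.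
    under eq_integral do rewrite poweRe1 ?lee_fin//.
    move=> H; apply: le_trans (H _ _ _ _ _ _ _) _ => //.
    - exact/measurable_EFinP.
    - exact/measurable_EFinP.
    - by move=> i; apply/measurable_EFinP.
    - by apply: lee_wpmul2l => //; apply: integral_ge0 => x _; rewrite lee_fin.
  (* [G] is used twice: with the weight [\1_Omega] it bounds the integral of [psi], and then with
     the weight [psi] that of its square. *)
  have I1 : (\int[lebesgue_rV 1]_x (psi x)%:E <= lebesgue_rV 1 Omega * A%:E)%E.
    have mI : measurable_fun setT (\1_Omega : _ -> R) by exact: measurable_indic.
    have := G _ mI (fun x => _); rewrite integral_indic// setIT => H.
    apply: le_trans (H _); last by move=> x; rewrite indicE.
    apply: ge0_le_integral => //.
    - by move=> x _; rewrite lee_fin.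
    - exact/measurable_EFinP.
    - by apply/measurable_EFinP; exact: measurable_funM.
    - move=> x _; rewrite lee_fin indicE.
      have [xO|xO] := boolP (x \in Omega); first by rewrite mul1r.
      by rewrite psi0 ?mulr0// => Ox; apply: (negP xO); rewrite inE.
  have -> : (\int[lebesgue_rV 1]_x (psi x `^ 2)%:E = \int[lebesgue_rV 1]_x (psi x * psi
    x)%:E)%E.
    by apply: eq_integral => x _; rewrite (powR_mulrn 2)// expr2.
  apply: (le_trans (G _ mpsi p0)).
  apply: (@le_trans _ _ (lebesgue_rV 1 Omega * A%:E * A%:E)%E).
    by apply: lee_wpmul2r => //; rewrite lee_fin.
  by rewrite (powR_mulrn 2)// EFinM fineK ?ge0_fin_numE// expr2 EFinM muleA.
have [m [mE m1 mS]] : exists m : R, [/\ m = n.+1%:R, 1 <= m & n.+2%:R = m + 1].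
  by exists n.+1%:R; split; rewrite ?ler1n ?natr1.
have m0 : 0 < m by exact: lt_le_trans m1.
have mN0 : m != 0 by rewrite gt_eqF.
have m1N0 : m + 1 != 0 by rewrite gt_eqF// addr_gt0.
pose k : R := (m + 1) / m.
exists k, 1; split => //.
- apply/andP; split; first by rewrite ltr_pdivlMr// mul1r ltrDl.
  by rewrite ler_pdivrMr//; lra.
- move=> p; rewrite /critical_exponent.
  have E : 2 / k - 1 = (m - 1) / (m + 1).
    rewrite /k; field; exact/andP.
  rewrite E; case: ifPn => [n1|]; last first.
    rewrite -ltnNge !ltnS leqn0 => /eqP n0 _.
    have -> : m = 1 by rewrite mE n0.
    by rewrite subrr mul0r mulr0.
  rewrite lte_fin mS.
  have m2 : 1 < m by rewrite mE ltr1n.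
  rewrite ltr_pdivlMr; last lra.
  by rewrite mulrA ltr_pdivrMr; lra.
move=> psi h A B mpsi psi0B psi0 mh h0 line A0 hA.
have p0 x : 0 <= psi x by case/andP: (psi0B x).
have k0 : 0 < k by rewrite divr_gt0// addr_gt0.
have mpk : measurable_fun setT (fun x => psi x `^ k).
  exact: (measurableT_comp (measurable_powR k)).
have B0 : 0 <= B by have /andP[] := psi0B 0; exact: le_trans.
have pk0 x : ~ Omega x -> psi x `^ k = 0 by move=> /psi0 ->; rewrite powR0 ?gt_eqF.
rewrite mul1r (integral_out_eq pk0).
set X := (\int[_]_(x in _) _)%E.
have X0 : (0 <= X)%E by apply: integral_ge0 => x _; rewrite lee_fin powR_ge0.
have Xfin : X \is a fin_num.
  apply: (integrable_fin_num mO).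
  apply: (@integrable_bounded_fun _ _ _ _ _ (B `^ k)) => //; first exact: measurable_funTS.
  move=> x _; rewrite ger0_norm ?powR_ge0//; have /andP[? ?] := psi0B x.
  by rewrite ge0_ler_powR ?nnegrE// ltW.
(* With weight [psi ^ k] the left-hand side reproduces [X], because [k / N + 1 = k]. The bound [B]
   makes [X] finite, so [X ^ (1 / N)] can be divided out; as [1 - 1 / N = 1 / k], this gives
   [X <= A ^ k]. *)
have : (X <= X `^ n.+2%:R^-1 * A%:E)%E.
  rewrite -{1}(fineK Xfin).
  have := @gagliardo_weighted R n.+1 (fun x => (psi x `^ k)%:E) (EFin \o psi) (fun i =>
    EFin \o h i).
  move=> H.
  have {}H := H _ _ _ _ _ _ _.
  rewrite fineK// {1}/X -(integral_out_eq pk0).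
  have -> : (\int[lebesgue_rV n.+2]_x (psi x `^ k)%:E =
     \int[lebesgue_rV n.+2]_x ((psi x `^ k)%:E `^ n.+2%:R^-1 * (EFin \o psi) x))%E.
    apply: eq_integral => x _; rewrite poweR_EFin -EFinM -powRrM.
    rewrite -[X in _ * X]powRr1// -powRD.
      by congr (_ `^ _)%:E; rewrite /k mS; field; exact/andP.
    apply/implyP; rewrite gt_eqF// addr_gt0// mulr_gt0// invr_gt0 mS; lra.
  apply: le_trans (H _ _ _ _ _ _ _) _ => //.
  - exact/measurable_EFinP.
  - by move=> x; rewrite lee_fin powR_ge0.
  - exact/measurable_EFinP.
  - by move=> i; apply/measurable_EFinP.
  - rewrite (integral_out_eq pk0) -/X; apply: lee_wpmul2l => //; exact: poweR_ge0.
rewrite -(fineK Xfin) poweR_EFin -EFinM !lee_fin.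
have : 0 <= fine X by exact: fine_ge0.
move: (fine X) => x; rewrite le_eqVlt => /orP[/eqP <- _|x0 xA]; first exact: powR_ge0.
have xe : x `^ (m / (m + 1)) <= A.
  have -> : m / (m + 1) = 1 - n.+2%:R^-1 by rewrite mS; field.
  rewrite powRB; last by rewrite (gt_eqF x0) implybT.
  rewrite powRr1; last exact: ltW.
  by rewrite ler_pdivrMr ?powR_gt0// mulrC.
have <- : (x `^ (m / (m + 1))) `^ k = x.
  rewrite -powRrM /k (_ : _ * _ = 1); first by rewrite powRr1// ltW.
  by field; exact/andP.
by rewrite ge0_ler_powR ?nnegrE ?powR_ge0// ltW.
Qed.

End gagliardo_section.

(** * The estimate for test functions with normalised gradient *)

Section sobolev_unit.
Context {R : realType} {n : nat}.
Variable Omega : set 'rV[R]_n.+1.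
Hypotheses (oO : open Omega) (bO : bounded_set Omega).
Local Notation leb := (@lebesgue_rV R n.+1).
Implicit Types phi : 'rV[R]_n.+1 -> R.

Let mO : measurable Omega. Proof. exact: open_measurable_rV. Qed.
Let finO : (leb Omega < +oo)%E. Proof. exact: bounded_lebesgue_rV_lty. Qed.

Lemma test_measurable phi : test_function Omega phi -> measurable_fun setT phi.
Proof. by move=> [sphi _ _]; apply: continuous_measurable_rV; exact: smooth_continuous. Qed.

Lemma test_partial_measurable phi i :
  test_function Omega phi -> measurable_fun setT (partial i phi).
Proof.
by move=> [sphi _ _]; apply: continuous_measurable_rV; exact: smooth_partial_continuous.
Qed.

Lemma integrable_bracket phi r : 0 <= r -> test_function Omega phi ->
  leb.-integrable Omega (EFin \o (fun x => bracket phi x `^ r)).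
Proof.
move=> r0 tphi; have [B B0 phiB] := test_bounded tphi.
apply: (@integrable_bounded_fun _ _ _ _ _ _ ((1 + B ^+ 2) `^ r)) => //.
  apply: measurable_funTS; apply: continuous_measurable_rV.
  by apply: continuous_bracket; case: tphi => /smooth_continuous.
move=> x _; rewrite ger0_norm ?powR_ge0// ge0_ler_powR ?nnegrE ?bracket_ge0//.
  by rewrite addr_ge0// sqr_ge0.
by rewrite lerD2l -(real_normK (num_real (phi x))) lerXn2r ?nnegrE// ltW.
Qed.

Lemma integrable_partial_sqr phi i : test_function Omega phi ->
  leb.-integrable Omega (EFin \o (fun x => partial i phi x ^+ 2)).
Proof.
move=> tphi; have [B B0 phiB] := test_partial_bounded i tphi.
apply: (@integrable_bounded_fun _ _ _ _ _ _ (B ^+ 2)) => //.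
  apply: measurable_funTS; apply: measurable_funX; exact: test_partial_measurable.
by move=> x _; rewrite normrX lerXn2r ?nnegrE// ltW.
Qed.

Lemma sobolev_test_unit (p : R) : 2 < p -> (p%:E < @critical_exponent R n.+1)%E ->
  exists2 C, 0 <= C & forall phi, test_function Omega phi ->
    \sum_(i < n.+1) \int[leb]_(x in Omega) (partial i phi x ^+ 2) <= 1 ->
    \int[leb]_(x in Omega) (bracket phi x `^ (p / 2)) <= C.
Proof.
move=> p2 pcrit.
have [k [D [k12 D0 hp G]]] := gagliardo mO finO.
have {}hp := hp _ pcrit.
have k0 : 0 < k by lra.
have kN0 : k != 0 by rewrite gt_eqF.
(* With this [g] and [psi = bracket phi ^ (g / 2) - 1], the power [(psi + 1) ^ k] is the integrand
   [bracket phi ^ (p / 2)]. *)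
pose g := p / k.
have gk : g * k = p by rewrite /g mulfVK.
have g1 : 1 <= g by rewrite ler_pdivlMr// mul1r; lra.
have g0 : 0 < g by exact: lt_le_trans g1.
(* Subcriticality enters here: it makes [Z], defined below, of lower order than [Y]. *)
have gp : g - 1 < p / 2.
  have : p * (2 / k - 1) = 2 * g - p by rewrite /g; field.
  by move=> E; rewrite E in hp; lra.
pose m := fine (leb Omega).
have m0 : 0 <= m by exact: fine_ge0.
(* In [hA], each of the [n.+1] directions contributes one [s], and the sum of the gradient terms one
   more; hence [n.+2]. *)
pose c : R := g / 2 * n.+2%:R.
have c0 : 0 <= c by rewrite mulr_ge0// divr_ge0// ltW.
pose K := 2 `^ k * (D * c ^+ 2).
have K0 : 0 <= K by rewrite mulr_ge0 ?powR_ge0// mulr_ge0// sqr_ge0.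
(* Small enough for [K * e <= 1 / 2], so that half of [Y] survives the absorption. *)
pose e := (2 * (K + 1))^-1.
have e0 : 0 < e by rewrite invr_gt0 mulr_gt0// ltr_wpDl.
have Ke : K * e <= 2^-1.
  by rewrite /e invfM mulrCA ler_piMr// ler_pdivrMr ?mul1r ?lerDl// ltr_wpDl.
have [Ce Ce0 young] : exists2 C, 0 <= C & forall t, 0 <= t -> t `^ (g - 1) <= e * t `^
  (p / 2) + C.
  by apply: powR_le_eps_powR => //; rewrite subr_ge0.
pose K1 := 2 `^ k * (D * (1 + c ^+ 2) + m).
have K10 : 0 <= K1.
  by rewrite mulr_ge0 ?powR_ge0// addr_ge0// mulr_ge0// addr_ge0// sqr_ge0.
exists (2 * (K * (Ce * m) + K1)).
  by apply: mulr_ge0 => //; apply: addr_ge0 => //; apply: mulr_ge0 => //; exact: mulr_ge0.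
move=> phi tphi hgrad.
have sphi : smooth phi by case: tphi.
have mphi := test_measurable tphi.
have cphi := smooth_continuous sphi.
have p20 : 0 <= p / 2 by lra.
have g10 : 0 <= g - 1 by lra.
have mw r : measurable_fun setT (fun x => bracket phi x `^ r).
  by apply: continuous_measurable_rV; exact: continuous_bracket.
set Y := (X in X <= _).
pose Z := \int[leb]_(x in Omega) (bracket phi x `^ (g - 1)).
have Z0 : 0 <= Z by apply: Rintegral_ge0 => x _; exact: powR_ge0.
have ZY : Z <= e * Y + Ce * m.
  have -> : e * Y + Ce * m = \int[leb]_(x in Omega) (e * bracket phi x `^ (p / 2) + Ce).
    rewrite RintegralD//; last 2 first.
    - exact: (integrableZl mO e (integrable_bracket p20 tphi)).
    - exact: (@integrable_bounded_fun _ _ _ _ _ _ `|Ce|).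
    by rewrite RintegralZl ?Rintegral_cst//; exact: integrable_bracket.
  apply: le_Rintegral => //.
  - exact: integrable_bracket.
  - rewrite (_ : _ \o _ = (EFin \o (fun x => e * bracket phi x `^ (p / 2))) \+ (EFin \o
    cst Ce))//.
    apply: integrableD => //.
      exact: (integrableZl mO e (integrable_bracket p20 tphi)).
    exact: (@integrable_bounded_fun _ _ _ _ _ _ `|Ce|).
  - by move=> x _; apply: young; exact: bracket_ge0.
(* Weighted arithmetic-geometric mean with parameter [s] replaces the Cauchy-Schwarz inequality. The
   added 1 keeps [s] positive, and [s^-1 * Z <= s]. *)
pose s := Num.sqrt (1 + Z).
have Z1 : 0 < 1 + Z by rewrite ltr_pwDl.
have s0 : 0 < s by rewrite sqrtr_gt0.
have s2 : s ^+ 2 = 1 + Z by rewrite sqr_sqrtr// ltW.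
pose A := c * s.
have A0 : 0 <= A by rewrite mulr_ge0// ltW.
pose psi x := bracket phi x `^ (g / 2) - 1.
pose h i x := g * bracket phi x `^ ((g - 1) / 2) * `|partial i phi x|.
have g20 : 0 <= g / 2 by lra.
have psi0 x : 0 <= psi x by rewrite subr_ge0 bracket_powR_ge1.
have [B B0 phiB] := test_bounded tphi.
have psiB x : 0 <= psi x <= (1 + B ^+ 2) `^ (g / 2).
  rewrite psi0/= lerBlDr ler_wpDr// ge0_ler_powR ?nnegrE ?bracket_ge0//.
    by rewrite addr_ge0// sqr_ge0.
  by rewrite lerD2l -(real_normK (num_real (phi x))) lerXn2r ?nnegrE// ltW.
have mpsi : measurable_fun setT psi by apply: measurable_funB.
have psiO x : ~ Omega x -> psi x = 0.
  by move=> /(test_function_out tphi) E; rewrite /psi /bracket E expr0n/= addr0 powR1 subrr.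
have mh i : measurable_fun setT (h i).
  apply: measurable_funM; first by apply: measurable_funM.
  by apply: measurableT_comp => //; exact: test_partial_measurable.
have h0 i x : 0 <= h i x.
  by apply: mulr_ge0 => //; apply: mulr_ge0; [exact: ltW|exact: powR_ge0].
have line i x : ((psi x)%:E <= \int[lebesgue_measure]_s (h i (set_coord x i s))%:E)%E.
  exact: (test_line_bound x i bO tphi g1).
have hO i x : ~ Omega x -> h i x = 0.
  by move=> /(test_partial_out i tphi) E; rewrite /h E normr0 mulr0.
have ih i : leb.-integrable Omega (EFin \o h i).
  have [B' B'0 dB] := test_partial_bounded i tphi.
  apply: (@integrable_bounded_fun _ _ _ _ _ _ (g * (1 + B ^+ 2) `^ ((g - 1) / 2) * B')) => //.
    exact: measurable_funTS.
  move=> x _; rewrite ger0_norm//; apply: ler_pM => //.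
    by rewrite mulr_ge0 ?powR_ge0// ltW.
  rewrite ler_pM2l// ge0_ler_powR ?nnegrE ?bracket_ge0 ?divr_ge0//.
    by rewrite addr_ge0// sqr_ge0.
  by rewrite lerD2l -(real_normK (num_real (phi x))) lerXn2r ?nnegrE// ltW.
have hI i : \int[leb]_(x in Omega) h i x <=
    g / 2 * (s^-1 * Z + s * \int[leb]_(x in Omega) (partial i phi x ^+ 2)).
  have i1 := integrable_bracket g10 tphi.
  have i2 := integrable_partial_sqr i tphi.
  have i1' := integrableZl mO (g / 2 * s^-1) i1.
  have i2' := integrableZl mO (g / 2 * s) i2.
  rewrite mulrDr !mulrA -!RintegralZl// -RintegralD//.
  apply: le_Rintegral => //; first exact: (integrableD mO i1' i2').
  move=> x _; rewrite /h.
  have -> : bracket phi x `^ (g - 1) = (bracket phi x `^ ((g - 1) / 2)) ^+ 2.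
    by rewrite -powR_mulrn ?powR_ge0// -powRrM mulfVK.
  set a := bracket phi x `^ _; rewrite -(real_normK (num_real (partial i phi x))).
  set b := `|_|.
  have -> : g / 2 / s * a ^+ 2 + g / 2 * s * b ^+ 2 =
      g * a * b + g / 2 / s * (a - s * b) ^+ 2 by field; rewrite gt_eqF.
  by rewrite lerDl mulr_ge0 ?sqr_ge0// divr_ge0// ltW.
have hA : (\sum_(i < n.+1) \int[leb]_x (h i x)%:E <= A%:E)%E.
  rewrite (eq_bigr (fun i => (\int[leb]_(x in Omega) h i x)%:E)); last first.
    by move=> i _; rewrite (integral_out_eq (hO i)) fineK//; exact: (integrable_fin_num
      mO (ih i)).
  rewrite sumEFin lee_fin.
  apply: le_trans (ler_sum _ (fun i _ => hI i)) _.
  rewrite -mulr_sumr big_split/= sumr_const card_ord -mulr_sumr /A /c -[leRHS]mulrA.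
  apply: ler_wpM2l => //.
  have sZ : s^-1 * Z <= s.
    by rewrite ler_pdivrMl// -expr2 s2 lerDr.
  rewrite -[n.+2%:R]natr1 mulrDl mul1r mulr_natl lerD//.
    by rewrite ler_wMn2r.
  by rewrite ler_piMr// ltW.
have := G psi h A _ mpsi psiB psiO mh h0 line A0 hA.
have pk0 x : ~ Omega x -> psi x `^ k = 0 by move=> /psiO ->; rewrite powR0 ?gt_eqF.
rewrite (integral_out_eq pk0) => GX.
have ipk : leb.-integrable Omega (EFin \o (fun x => psi x `^ k)).
  apply: (@integrable_bounded_fun _ _ _ _ _ _ (((1 + B ^+ 2) `^ (g / 2)) `^ k)) => //.
    by apply: measurable_funTS; exact: (measurableT_comp (measurable_powR k)).
  move=> x _; rewrite ger0_norm ?powR_ge0// ge0_ler_powR ?nnegrE ?powR_ge0//.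
    exact: ltW.
  by case/andP: (psiB x).
(* Since [k <= 2], the power [A ^ k] may be traded for [1 + A ^+ 2], which is affine in [Z]. *)
have {}GX : \int[leb]_(x in Omega) (psi x `^ k) <= D * (1 + A ^+ 2).
  have : \int[leb]_(x in Omega) (psi x `^ k) <= D * A `^ k.
    by rewrite -lee_fin /Rintegral fineK//; exact: (integrable_fin_num mO ipk).
  move/le_trans; apply; rewrite ler_wpM2l// powR_le_1D2//; lra.
have YX : Y <= 2 `^ k * (\int[leb]_(x in Omega) (psi x `^ k) + m).
  have icst : leb.-integrable Omega (EFin \o cst (1 : R)).
    exact: (@integrable_bounded_fun _ _ _ _ _ _ `|1|).
  have isum := integrableD mO ipk icst.
  have -> : \int[leb]_(x in Omega) (psi x `^ k) + m =
      \int[leb]_(x in Omega) (psi x `^ k + 1).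
    by rewrite RintegralD// Rintegral_cst// mul1r.
  rewrite -RintegralZl//.
  apply: le_Rintegral => //.
  - exact: integrable_bracket.
  - exact: (integrableZl mO (2 `^ k) isum).
  move=> x _.
  have -> : bracket phi x `^ (p / 2) = (psi x + 1) `^ k.
    by rewrite subrK -powRrM; congr (_ `^ _); rewrite -gk; field.
  by have := powRD_le (psi0 x) ler01 (ltW k0); rewrite powR1.
have : Y <= K * Z + K1.
  apply: le_trans YX _.
  have -> : K * Z + K1 = 2 `^ k * (D * (1 + A ^+ 2) + m).
    have -> : A ^+ 2 = c ^+ 2 * (1 + Z) by rewrite -s2 -exprMn.
    by rewrite /K /K1; ring.
  by rewrite ler_pM2l ?powR_gt0// lerD2r.
move=> YZ.
have Y0 : 0 <= Y by apply: Rintegral_ge0 => x _; exact: powR_ge0.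
(* The absorption: [Y <= K * Z + K1] now bounds [Y] by [Y / 2] plus a constant independent of
   [phi]. *)
have KZ : K * Z <= 2^-1 * Y + K * (Ce * m).
  apply: (@le_trans _ _ (K * (e * Y + Ce * m))); first exact: ler_wpM2l.
  by rewrite mulrDr mulrA lerD2r ler_wpM2r.
lra.
Qed.

End sobolev_unit.

(** * The space H^1_0 and its embedding in L^p *)

Section L2_pairs.
Context {R : realType} {n : nat}.
Variable Omega : set 'rV[R]_n.+1.
Hypotheses (oO : open Omega) (bO : bounded_set Omega).
Local Notation leb := (@lebesgue_rV R n.+1).
Implicit Types (u v w : @sobolev R n.+1) (f g : 'rV[R]_n.+1 -> R).

Let mO : measurable Omega. Proof. exact: open_measurable_rV. Qed.
Let finO : (leb Omega < +oo)%E. Proof. exact: bounded_lebesgue_rV_lty. Qed.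

Lemma integrable_le f g : measurable_fun Omega f ->
  leb.-integrable Omega (EFin \o g) -> (forall x, Omega x -> `|f x| <= g x) ->
  leb.-integrable Omega (EFin \o f).
Proof.
move=> mf ig fg; apply: (le_integrable mO _ _ ig); first exact/measurable_EFinP.
by move=> x Ox; rewrite /= lee_fin; apply: le_trans (fg x Ox) (ler_norm _).
Qed.

Lemma integrable_addZ f g (c : R) :
  leb.-integrable Omega (EFin \o f) -> leb.-integrable Omega (EFin \o g) ->
  leb.-integrable Omega (EFin \o (fun x => f x + c * g x)).
Proof. by move=> fi gi; exact: (integrableD mO fi (integrableZl mO c gi)). Qed.

Lemma Rintegral_addZ f g (c : R) :
  leb.-integrable Omega (EFin \o f) -> leb.-integrable Omega (EFin \o g) ->
  \int[leb]_(x in Omega) (f x + c * g x) =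
  \int[leb]_(x in Omega) f x + c * \int[leb]_(x in Omega) g x.
Proof.
move=> fi gi; rewrite RintegralD//; last exact: (integrableZl mO c gi).
by rewrite RintegralZl.
Qed.

Lemma integrable_cst_Omega (c : R) : leb.-integrable Omega (EFin \o (fun=> c)).
Proof. exact: (@integrable_bounded_fun _ _ _ _ _ _ `|c|). Qed.

Lemma L2_mul f g : L2 Omega f -> L2 Omega g ->
  leb.-integrable Omega (EFin \o (fun x => f x * g x)).
Proof.
move=> [mf i_f] [mg ig].
apply: (@integrable_le _ (fun x => f x ^+ 2 + 1 * g x ^+ 2)).
- exact: measurable_funM.
- exact: integrable_addZ.
- move=> x _; rewrite mul1r normrM -(real_normK (num_real (f x))) -(real_normK
  (num_real (g x))).
  set a := `|f x|; set b := `|g x|.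
  have -> : a ^+ 2 + b ^+ 2 = a * b + (a * b + (a - b) ^+ 2) by ring.
  rewrite lerDl; apply: addr_ge0; last exact: sqr_ge0.
  by apply: mulr_ge0; exact: normr_ge0.
Qed.

Lemma L2_addZ f g (c : R) : L2 Omega f -> L2 Omega g ->
  L2 Omega (fun x => f x + c * g x).
Proof.
move=> [mf i_f] [mg ig].
have mfg : measurable_fun Omega (fun x => f x + c * g x).
  by apply: measurable_funD => //; exact: measurable_funM.
split => //; apply: (@integrable_le _ (fun x => 2 * f x ^+ 2 + (2 * c ^+ 2) * g x ^+ 2)).
- exact: measurable_funX.
- by apply: integrable_addZ => //; exact: (integrableZl mO 2 i_f).
- move=> x _; rewrite ger0_norm ?sqr_ge0//.
  set a := f x; set b := g x.
  have -> : 2 * a ^+ 2 + 2 * c ^+ 2 * b ^+ 2 = (a + c * b) ^+ 2 + (a - c * b) ^+ 2 by ring.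
  by rewrite lerDl sqr_ge0.
Qed.

(** The part of [H1] on which the expansions of the two quadratic forms rely. A test function with
    its classical gradient can thus be compared with a Sobolev pair without integrating by parts. *)
Definition L2pair w := L2 Omega w.1 /\ forall i, L2 Omega (fun x => w.2 x ord0 i).

Lemma sobolev_fst u v (c : R) x : (u + c *: v).1 x = u.1 x + c * v.1 x.
Proof. by []. Qed.

Lemma sobolev_snd u v (c : R) x i :
  (u + c *: v).2 x ord0 i = u.2 x ord0 i + c * v.2 x ord0 i.
Proof. by rewrite [(u + c *: v).2]/= !mxE. Qed.

Lemma L2pair_addZ u v (c : R) : L2pair u -> L2pair v -> L2pair (u + c *: v).
Proof.
move=> [u1 u2] [v1 v2]; split; first exact: (L2_addZ c u1 v1).
move=> i; have := L2_addZ c (u2 i) (v2 i).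
by congr (L2 _ _); apply/funext => x; rewrite sobolev_snd.
Qed.

Lemma H10dot_integrable u v : L2pair u -> L2pair v ->
  leb.-integrable Omega (EFin \o (fun x => \sum_(i < n.+1) u.2 x ord0 i * v.2 x ord0 i)).
Proof.
move=> [_ u2] [_ v2].
rewrite (_ : _ \o _ = (fun x => \sum_(i < n.+1) (u.2 x ord0 i * v.2 x ord0 i)%:E)%E);
  last first.
  by apply/funext => x /=; rewrite sumEFin.
by apply: integrable_sum => // i _; exact: (L2_mul (u2 i) (v2 i)).
Qed.

Lemma L2dot_expand u v (c : R) : L2pair u -> L2pair v ->
  L2dot Omega (u + c *: v) (u + c *: v) =
  L2dot Omega u u + 2 * c * L2dot Omega u v + c ^+ 2 * L2dot Omega v v.
Proof.
move=> [u1 _] [v1 _]; rewrite /L2dot.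
have iuu := L2_mul u1 u1; have iuv := L2_mul u1 v1; have ivv := L2_mul v1 v1.
have iuuv := integrable_addZ (2 * c) iuu iuv.
rewrite -Rintegral_addZ// -Rintegral_addZ//.
by apply: eq_Rintegral => x _; rewrite sobolev_fst; ring.
Qed.

Lemma H10dot_expand u v (c : R) : L2pair u -> L2pair v ->
  H10dot Omega (u + c *: v) (u + c *: v) =
  H10dot Omega u u + 2 * c * H10dot Omega u v + c ^+ 2 * H10dot Omega v v.
Proof.
move=> pu pv; rewrite /H10dot.
have iuu := H10dot_integrable pu pu; have iuv := H10dot_integrable pu pv.
have ivv := H10dot_integrable pv pv.
have iuuv := integrable_addZ (2 * c) iuu iuv.
rewrite -Rintegral_addZ// -Rintegral_addZ//.
apply: eq_Rintegral => x _; rewrite !mulr_sumr -!big_split/=.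
by apply: eq_bigr => i _; rewrite sobolev_snd; ring.
Qed.

Lemma L2dot_ge0 u : 0 <= L2dot Omega u u.
Proof. by apply: Rintegral_ge0 => x _; rewrite -expr2 sqr_ge0. Qed.

Lemma H10dot_ge0 u : 0 <= H10dot Omega u u.
Proof. by apply: Rintegral_ge0 => x _; apply: sumr_ge0 => i _; rewrite -expr2 sqr_ge0. Qed.

Lemma L2norm_sqr u : L2norm Omega u ^+ 2 = L2dot Omega u u.
Proof. by rewrite sqr_sqrtr// L2dot_ge0. Qed.

Lemma H10norm_sqr u : H10norm Omega u ^+ 2 = H10dot Omega u u.
Proof. by rewrite sqr_sqrtr// H10dot_ge0. Qed.

(** The values at [t] and [- t] add up to the right-hand side, as in the parallelogram law. *)
Lemma quadratic_disc (a b c : R) : (forall t : R, 0 <= a + 2 * t * b + t ^+ 2 * c) ->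
  forall t : R, a + 2 * t * b + t ^+ 2 * c <= 2 * a + 2 * t ^+ 2 * c.
Proof. by move=> H t; have := H (- t); lra. Qed.

Lemma L2dot_addZ_le u v (c : R) : L2pair u -> L2pair v ->
  L2dot Omega (u + c *: v) (u + c *: v) <= 2 * L2dot Omega u u + 2 * c ^+ 2 * L2dot Omega v v.
Proof.
move=> pu pv; rewrite L2dot_expand//; apply: quadratic_disc => t.
by rewrite -L2dot_expand// L2dot_ge0.
Qed.

Lemma H10dot_addZ_le u v (c : R) : L2pair u -> L2pair v ->
  H10dot Omega (u + c *: v) (u + c *: v) <= 2 * H10dot Omega u u + 2 * c ^+ 2 * H10dot
    Omega v v.
Proof.
move=> pu pv; rewrite H10dot_expand//; apply: quadratic_disc => t.
by rewrite -H10dot_expand// H10dot_ge0.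
Qed.

Lemma test_L2 phi : test_function Omega phi -> L2 Omega phi.
Proof.
move=> tphi; have mphi := measurable_funTS (D := Omega) (test_measurable tphi).
split => //; have [B B0 pB] := test_bounded tphi.
apply: (@integrable_bounded_fun _ _ _ _ _ _ (B ^+ 2)) => //; first exact: measurable_funX.
by move=> x _; rewrite normrX lerXn2r ?nnegrE// ltW.
Qed.

Lemma test_partial_L2 phi i : test_function Omega phi -> L2 Omega (partial i phi).
Proof.
move=> tphi; split; first exact: measurable_funTS (test_partial_measurable i tphi).
exact: (integrable_partial_sqr oO bO).
Qed.

Lemma test_L2pair phi : test_function Omega phi -> L2pair ((phi, gradient phi) :
  @sobolev R n.+1).
Proof.
move=> tphi; split; first exact: test_L2.
move=> i; have := test_partial_L2 i tphi.
by congr (L2 _ _); apply/funext => x; rewrite /= mxE.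
Qed.

Lemma H1_L2pair u : H1 Omega u -> L2pair u.
Proof. by move=> [u1 u2 _]; split. Qed.

Lemma H10_L2pair u : H10 Omega u -> L2pair u.
Proof. by move=> [/H1_L2pair]. Qed.

Lemma H1_addZ u v (c : R) : H1 Omega u -> H1 Omega v -> H1 Omega (u + c *: v).
Proof.
move=> hu hv; have pu := H1_L2pair hu; have pv := H1_L2pair hv.
have [uv1 uv2] := L2pair_addZ c pu pv.
case: hu => u1 u2 uw; case: hv => v1 v2 vw.
split => // phi tphi i.
have tp := test_partial_L2 i tphi; have t := test_L2 tphi.
transitivity (\int[leb]_(x in Omega) (u.1 x * partial i phi x + c * (v.1 x * partial i
  phi x))).
  by apply: eq_Rintegral => x _; rewrite sobolev_fst; ring.
rewrite Rintegral_addZ; [|exact: L2_mul..].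
rewrite (uw phi tphi i) (vw phi tphi i) mulrN -opprD -Rintegral_addZ;
  [|exact: (L2_mul (u2 i))|exact: (L2_mul (v2 i))].
by congr (- _); apply: eq_Rintegral => x _; rewrite sobolev_snd; ring.
Qed.

Lemma H10_addZ u v (c : R) : H10 Omega u -> H10 Omega v -> H10 Omega (u + c *: v).
Proof.
move=> [hu [phi tphi cphi]] [hv [psi tpsi cpsi]].
split; first exact: H1_addZ.
exists (fun k => phi k + c *: psi k); first by move=> k; exact: test_functionD.
move=> d.
pose a k : @sobolev R n.+1 := (phi k, gradient (phi k)) - u.
pose b k : @sobolev R n.+1 := (psi k, gradient (psi k)) - v.
have pa k : L2pair (a k).
  by rewrite /a -scaleN1r; apply: L2pair_addZ; [exact: test_L2pair|exact: H1_L2pair].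
have pb k : L2pair (b k).
  by rewrite /b -scaleN1r; apply: L2pair_addZ; [exact: test_L2pair|exact: H1_L2pair].
have dE k : d k = a k + c *: b k.
  rewrite /d /a /b scalerBr opprD addrACA; congr (_ + _).
  by congr pair; rewrite gradientD//; [case: (tphi k)|case: (tpsi k)].
apply: (@squeeze_cvgr _ _ _ _ (cst 0) (fun k =>
   2 * (L2dot Omega (a k) (a k) + H10dot Omega (a k) (a k)) +
   2 * c ^+ 2 * (L2dot Omega (b k) (b k) + H10dot Omega (b k) (b k)))).
- near=> k; rewrite addr_ge0 ?L2dot_ge0 ?H10dot_ge0//= dE.
  have := L2dot_addZ_le c (pa k) (pb k); have := H10dot_addZ_le c (pa k) (pb k); lra.
- exact: cvg_cst.
- have -> : (0 : R) = 2 * 0 + 2 * c ^+ 2 * 0 by rewrite !mulr0 addr0.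
  apply: cvgD; apply: cvgM => //; exact: cvg_cst.
Unshelve. all: by end_near. Qed.

Lemma H10_scale u (c : R) : H10 Omega u -> H10 Omega (c *: u).
Proof.
move=> hu; have -> : c *: u = u + (c - 1) *: u by rewrite scalerBl scale1r addrC subrK.
exact: H10_addZ.
Qed.

End L2_pairs.

Section sobolev_H10.
Context {R : realType} {n : nat}.
Variable Omega : set 'rV[R]_n.+1.
Hypotheses (oO : open Omega) (bO : bounded_set Omega).
Local Notation leb := (@lebesgue_rV R n.+1).
Implicit Types (u v w : @sobolev R n.+1) (f g : 'rV[R]_n.+1 -> R).

Let mO : measurable Omega. Proof. exact: open_measurable_rV. Qed.
Let finO : (leb Omega < +oo)%E. Proof. exact: bounded_lebesgue_rV_lty. Qed.

Variable p : R.
Hypotheses (p2 : 2 < p) (pcrit : (p%:E < @critical_exponent R n.+1)%E).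

Let p0 : 0 < p. Proof. by apply: lt_trans p2. Qed.

Definition Lp f := measurable_fun Omega f /\
  leb.-integrable Omega (EFin \o (fun x => `|f x| `^ p)).

Lemma measurable_norm_powR f r : measurable_fun Omega f ->
  measurable_fun Omega (fun x => `|f x| `^ r).
Proof.
move=> mf; apply: (measurableT_comp (measurable_powR r)).
exact: measurableT_comp.
Qed.

Lemma test_Lp phi : test_function Omega phi -> Lp phi.
Proof.
move=> tphi; have mphi := measurable_funTS (D := Omega) (test_measurable tphi).
split => //; have [B B0 pB] := test_bounded tphi.
apply: (@integrable_bounded_fun _ _ _ _ _ _ (B `^ p)) => //.
  exact: measurable_norm_powR.
move=> x _; rewrite ger0_norm ?powR_ge0// ge0_ler_powR ?nnegrE ?(ltW p0) ?(ltW B0)//.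
Qed.

(** The normalised estimate is applied to [phi / G]. Taking for [G] any positive upper bound of the
    gradient norm, instead of the norm itself, avoids a case distinction when the norm is zero. *)
Lemma sobolev_test : exists2 C, 0 <= C & forall phi (G : R), test_function Omega phi ->
  0 < G ->
  H10dot Omega ((phi, gradient phi) : sobolev) ((phi, gradient phi) : sobolev) <= G ^+ 2 ->
  \int[leb]_(x in Omega) (`|phi x| `^ p) <= C * G `^ p.
Proof.
have [C C0 HC] := sobolev_test_unit oO bO p2 pcrit.
exists C => // phi G tphi G0 hG.
pose psi := phi + (G^-1 - 1) *: phi.
have psiE x : psi x = G^-1 * phi x by rewrite /psi !fctE /GRing.scale/=; ring.
have tpsi : test_function Omega psi by exact: test_functionD.
have sphi : smooth phi by case: tphi.
have dpsi i x : partial i psi x = G^-1 * partial i phi x.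
  rewrite /psi partialD; [|by move=> y; exact: smooth_derivable..].
  by rewrite !fctE /GRing.scale/=; ring.
have h1 : \sum_(i < n.+1) \int[leb]_(x in Omega) (partial i psi x ^+ 2) <= 1.
  have -> : \sum_(i < n.+1) \int[leb]_(x in Omega) (partial i psi x ^+ 2) =
     G ^- 2 * H10dot Omega ((phi, gradient phi) : sobolev) ((phi, gradient phi) : sobolev).
    rewrite /H10dot.
    have -> : \int[leb]_(x in Omega) (\sum_(i < n.+1) gradient phi x ord0 i * gradient
      phi x ord0 i) =
        \sum_(i < n.+1) \int[leb]_(x in Omega) (partial i phi x ^+ 2).
      rewrite /Rintegral.
      have -> : (\int[leb]_(x in Omega) (\sum_(i < n.+1) gradient phi x ord0 i *
        gradient phi x ord0 i)%:E =
         \int[leb]_(x in Omega) \sum_(i < n.+1) (partial i phi x ^+ 2)%:E)%E.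
        apply: eq_integral => x _; rewrite sumEFin; congr (_%:E).
        by apply: eq_bigr => i _; rewrite !mxE expr2.
      rewrite integral_sum//; last by move=> i; exact: integrable_partial_sqr.
      rewrite (eq_bigr (fun i => (\int[leb]_(x in Omega) (partial i phi x ^+ 2))%:E)).
        by rewrite sumEFin.
      move=> i _; rewrite fineK//; apply: integrable_fin_num => //.
      exact: integrable_partial_sqr.
    rewrite mulr_sumr; apply: eq_bigr => i _.
    rewrite -RintegralZl//; last exact: integrable_partial_sqr.
    by apply: eq_Rintegral => x _; rewrite dpsi exprMn exprVn.
  by rewrite ler_pdivrMl ?mulr1// exprn_gt0.
have := HC psi tpsi h1.
have p20 : 0 <= p / 2 by rewrite divr_ge0// ltW.
have [_ ipsi] := test_Lp tpsi; have [_ iphi] := test_Lp tphi.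
have : \int[leb]_(x in Omega) (`|psi x| `^ p) <= \int[leb]_(x in Omega) (bracket psi x
  `^ (p / 2)).
  apply: le_Rintegral => //; first exact: integrable_bracket.
  move=> x _; have -> : p / 2 = 2^-1 * p by rewrite mulrC.
  rewrite powRrM; apply: ge0_ler_powR; rewrite ?nnegrE ?powR_ge0 ?(ltW p0)//.
  exact: norm_le_bracket.
move=> /le_trans /[apply].
have -> : \int[leb]_(x in Omega) (`|psi x| `^ p) =
    (G `^ p)^-1 * \int[leb]_(x in Omega) (`|phi x| `^ p).
  rewrite -RintegralZl//; apply: eq_Rintegral => x _.
  rewrite psiE normrM powRM// ger0_norm ?invr_ge0 ?(ltW G0)//.
  by rewrite -powR_inv1 ?(ltW G0)// -powRrM mulN1r powRN.
by rewrite ler_pdivrMl ?powR_gt0// mulrC.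
Qed.

(* Truncating at height [M] replaces a.e. convergence of the approximating
   sequence: convergence in L^2 suffices for the bounded part. *)
Lemma trunc_powR_le (M a b : R) : 0 <= M -> `|a| <= M ->
  `|a| `^ p <= 2 `^ p * `|b| `^ p + (2 `^ p + M `^ p) * (b - a) ^+ 2.
Proof.
move=> M0 aM; have p0' : 0 <= p by exact: ltW.
(* When [|b - a| <= 1], its [p]-th power is at most its square because [p > 2]; otherwise the square
   exceeds 1 and the truncation height alone bounds the left-hand side. *)
have [d1|d1] := leP `|b - a| 1.
  have : `|a| `^ p <= (`|b| + `|b - a|) `^ p.
    apply: ge0_ler_powR; rewrite ?nnegrE ?addr_ge0//.
    by rewrite -[in leLHS](subKr b a); exact: ler_normB.
  move/le_trans; apply; apply: le_trans (powRD_le _ _ p0') _ => //.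
  rewrite mulrDr lerD2l mulrDl ler_wpDr//.
    by rewrite mulr_ge0 ?powR_ge0 ?sqr_ge0.
  rewrite ler_wpM2l ?powR_ge0// -[leRHS]real_normK ?num_real// -powR_mulrn//.
  have [->|d0] := eqVneq (b - a) 0; first by rewrite normr0 !powR0 ?gt_eqF//; lra.
  by apply: ger_powR; rewrite ?normr_gt0 ?d0//= ltW.
apply: ler_wpDl; first by rewrite mulr_ge0 ?powR_ge0.
apply: (@le_trans _ _ (M `^ p)); first by rewrite ge0_ler_powR ?nnegrE.
rewrite mulrDl; apply: ler_wpDl; first by rewrite mulr_ge0 ?powR_ge0 ?sqr_ge0.
apply: ler_peMr; first exact: powR_ge0.
by rewrite -[leRHS]real_normK ?num_real// expr_ge1// ltW.
Qed.

(** The truncated integrals are bounded uniformly in the height [k], and monotone convergence in [k]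
    then gives both integrability and the bound. *)
Lemma sobolev_H10 : exists2 C, 0 <= C & forall u (G : R), H10 Omega u -> 0 < G ->
  H10dot Omega u u <= G ^+ 2 ->
  Lp u.1 /\ \int[leb]_(x in Omega) (`|u.1 x| `^ p) <= C * G `^ p.
Proof.
have [C C0 HC] := sobolev_test.
(* One factor [2 ^ p] comes from [trunc_powR_le]; the other from the approximating test function,
   whose gradient norm is only bounded by [2 * G]. *)
exists (2 `^ p * (C * 2 `^ p)); first by rewrite !mulr_ge0 ?powR_ge0.
move=> u G hu G0 hG; have [mu _] := (H10_L2pair hu).1.
pose K := 2 `^ p * (C * 2 `^ p) * G `^ p.
have trunc (k : nat) : (\int[leb]_(x in Omega) (if (`|u.1 x| <= k%:R)%R then `|u.1 x|
  `^ p else 0)%:E <= K%:E)%E.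
  set T := fun x => if `|u.1 x| <= k%:R then `|u.1 x| `^ p else 0.
  have mT : measurable_fun Omega T.
    apply: measurable_fun_if => //.
    - by apply: measurable_fun_ler => //; exact: measurableT_comp.
    - apply: measurable_funS (measurable_norm_powR p mu) => //.
  have iT : leb.-integrable Omega (EFin \o T).
    apply: (@integrable_bounded_fun _ _ _ _ _ _ (k%:R `^ p)) => //.
    move=> x _; rewrite /T; case: ifP => [uk|_]; last by rewrite normr0 powR_ge0.
    by rewrite ger0_norm ?powR_ge0// ge0_ler_powR ?nnegrE// ltW.
  rewrite -[leLHS]fineK; last exact: (integrable_fin_num mO iT).
  rewrite lee_fin; apply/ler_addgt0Pr => e e0.
  have [hu1 [phi tphi cphi]] := hu.
  pose L := 2 `^ p + k%:R `^ p.
  have L0 : 0 < L by rewrite ltr_pwDl ?powR_gt0// powR_ge0.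
  (* The first bound controls the gradient of the approximating test function; the second makes the
     truncation error at most [e]. *)
  pose dl := Num.min (G ^+ 2) (e / L).
  have dl0 : 0 < dl by rewrite lt_min exprn_gt0//= divr_gt0.
  move/cvgrPdist_lt: cphi => /(_ _ dl0)[j _ /(_ j (leqnn j))] /=.
  set d : sobolev := (_ - u)%R.
  rewrite sub0r normrN ger0_norm ?addr_ge0 ?L2dot_ge0 ?H10dot_ge0// => hd.
  have dG : H10dot Omega d d <= G ^+ 2.
    have : L2dot Omega d d + H10dot Omega d d < G ^+ 2 by apply: lt_le_trans hd _;
      rewrite ge_min lexx.
    have := L2dot_ge0 Omega d; lra.
  have dL : L * L2dot Omega d d <= e.
    have : L2dot Omega d d + H10dot Omega d d < e / L by apply: lt_le_trans hd _;
      rewrite ge_min lexx orbT.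
    have := H10dot_ge0 Omega d => ? ?; rewrite mulrC -ler_pdivlMr//; lra.
  have pu := H1_L2pair hu1.
  have pphi := test_L2pair oO bO (tphi j).
  have pd : L2pair Omega d by rewrite /d -scaleN1r; apply: L2pair_addZ.
  have Hphi : H10dot Omega ((phi j, gradient (phi j)) : sobolev) ((phi j, gradient (phi
    j)) : sobolev) <= (2 * G) ^+ 2.
    have -> : ((phi j, gradient (phi j)) : sobolev) = u + 1 *: d by rewrite scale1r /d
      addrC subrK.
    apply: le_trans (H10dot_addZ_le oO 1 pu pd) _.
    by rewrite expr1n exprMn; lra.
  have IP := HC (phi j) (2 * G) (tphi j) (mulr_gt0 (ltr0Sn _ 1) G0) Hphi.
  have [_ iphi] := test_Lp (tphi j).
  have id2 := L2_mul oO pd.1 pd.1.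
  have i1 := integrableZl mO (2 `^ p) iphi.
  have : \int[leb]_(x in Omega) T x <=
     \int[leb]_(x in Omega) (2 `^ p * `|phi j x| `^ p + L * (d.1 x * d.1 x)).
    apply: le_Rintegral => //; first exact: integrable_addZ.
    move=> x _; rewrite /T; case: ifPn => [uk|_]; last first.
      by rewrite addr_ge0// mulr_ge0 ?powR_ge0// -?expr2 ?sqr_ge0// ltW.
    by rewrite -expr2; exact: trunc_powR_le.
  move/le_trans; apply; rewrite Rintegral_addZ// RintegralZl// lerD//.
  rewrite /K; apply: le_trans (ler_wpM2l (powR_ge0 _ _) IP) _.
  by rewrite powRM ?(ltW G0)// !mulrA.
have mup : measurable_fun Omega (fun x => `|u.1 x| `^ p) by exact: measurable_norm_powR.
have lim : (\int[leb]_(x in Omega) (`|u.1 x| `^ p)%:E <= K%:E)%E.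
  pose g (k : nat) x := (if `|u.1 x| <= k%:R then `|u.1 x| `^ p else 0)%:E.
  have mg k : measurable_fun Omega (g k).
    apply/measurable_EFinP; apply: measurable_fun_if => //.
    - by apply: measurable_fun_ler => //; exact: measurableT_comp.
    - exact: measurable_funS mup.
  have g0 k x : Omega x -> (0 <= g k x)%E.
    by rewrite /g lee_fin; case: ifP => // _ _; exact: powR_ge0.
  have ndg x : Omega x -> {homo g^~ x : a b / (a <= b)%N >-> (a <= b)%E}.
    move=> _ a b ab; rewrite /g lee_fin; case: ifP => [ua|_].
      by rewrite (le_trans ua)// ler_nat.
    by case: ifP => // _; exact: powR_ge0.
  have cvgg : (\int[leb]_(x in Omega) g k x)%E @[k --> \oo] -->
      (\int[leb]_(x in Omega) limn (g^~ x))%E.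
    exact: cvg_monotone_convergence.
  have limg x : limn (g^~ x) = (`|u.1 x| `^ p)%:E.
    apply: lim_near_cst => //.
    have [k ? uk] : \forall k \near \oo, `|u.1 x| <= k%:R by exact: nbhs_infty_ger.
    by exists k => // m /= km; rewrite /g uk.
  under eq_integral do rewrite -limg.
  rewrite -(cvg_lim _ cvgg)//.
  apply: lime_le; first by apply/cvg_ex; eexists; exact: cvgg.
  by apply: nearW => k; exact: trunc.
have ip : leb.-integrable Omega (EFin \o (fun x => `|u.1 x| `^ p)).
  apply/integrableP; split; first exact/measurable_EFinP.
  under eq_integral do rewrite /= ger0_norm ?powR_ge0//.
  by apply: le_lt_trans lim _; rewrite ltry.
split; first by split.
by rewrite -lee_fin fineK//; exact: (integrable_fin_num mO ip).
Qed.

End sobolev_H10.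

(** * The energy *)

Section primitive_theory.
Context {R : realType}.
Variable f : R -> R.
Hypothesis cf : continuous f.

Let intf (a b : R) : lebesgue_measure.-integrable `[a, b] (EFin \o f).
Proof.
apply: continuous_compact_integrable; first exact: segment_compact.
exact: continuous_subspaceT.
Qed.

(** A base point below both [0] and [t] merges the two cases of [primitive], so that the fundamental
    theorem of calculus also applies across [0]. *)
Lemma primitive_shift (a t : R) : a < 0 -> a < t ->
  primitive f t = \int[lebesgue_measure]_(s in `[a, t]) f s -
                  \int[lebesgue_measure]_(s in `[a, 0]) f s.
Proof.
move=> a0 at_; rewrite /primitive; case: ifPn => [t0|]; last rewrite -ltNge => t0.
  rewrite (@Rintegral_itvB R f (BLeft a) (BRight t) 0)//.
  - rewrite Rintegral_itv_obnd_cbnd//.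
    by apply: integrableS (intf 0 t) => //; exact: subset_itv_oc_cc.
  - by rewrite bnd_simp ltW.
rewrite -opprB (@Rintegral_itvB R f (BLeft a) (BRight 0) t)//.
- rewrite Rintegral_itv_obnd_cbnd//.
  by apply: integrableS (intf t 0) => //; exact: subset_itv_oc_cc.
- by rewrite bnd_simp ltW.
- by rewrite bnd_simp ltW.
Qed.

Lemma is_derive_primitive (t : R) : is_derive t (1 : R) (primitive f) (f t).
Proof.
pose a := Num.min t 0 - 1.
have a0 : a < 0 by rewrite ltrBlDr add0r gt_min ltr01 orbT.
have at_ : a < t by rewrite ltrBlDr gt_min ltrDl ltr01.
have tt1 : t < t + 1 by rewrite ltrDl.
have [dG G'] := continuous_FTC1_closed tt1 (intf a (t + 1)) at_ (@cf t).
have dG' : is_derive t (1 : R) (fun x => \int[lebesgue_measure]_(s in `[a, x]) f s) (f t).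
  by apply: DeriveDef; [exact: dG|rewrite -derive1E; exact: G'].
have : is_derive t (1 : R) ((fun x => \int[lebesgue_measure]_(s in `[a, x]) f s) -
   cst (\int[lebesgue_measure]_(s in `[a, 0]) f s)) (f t - 0).
  exact: is_deriveB.
rewrite subr0; apply: near_eq_is_derive.
near=> x; rewrite (@primitive_shift a x)//.
near: x; exact: lt_nbhsr.
Unshelve. all: by end_near. Qed.

Lemma primitive_MVT (a b : R) : a < b ->
  exists2 c, c \in `]a, b[ & primitive f b - primitive f a = f c * (b - a).
Proof.
move=> ab; apply: MVT => //; first by move=> x _; exact: is_derive_primitive.
by apply: derivable_within_continuous => x _; have [] := is_derive_primitive x.
Qed.

Lemma primitive0 : primitive f 0 = 0.
Proof. by rewrite /primitive lexx set_itv1 Rintegral_set1. Qed.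

Lemma continuous_primitive : continuous (primitive f).
Proof.
move=> x; apply: differentiable_continuous; apply/derivable1_diffP.
by have [] := is_derive_primitive x.
Qed.

Hypotheses (f0 : f 0 = 0) (cf2 : cond_f2 f).

Lemma f_ge0 t : 0 <= t -> 0 <= f t.
Proof.
rewrite le_eqVlt => /orP[/eqP <-|t0]; first by rewrite f0.
by have := cf2.1 t; rewrite pmulr_lge0.
Qed.

Lemma f_le0 t : t <= 0 -> f t <= 0.
Proof.
rewrite le_eqVlt => /orP[/eqP ->|t0]; first by rewrite f0.
by have := cf2.1 t; rewrite nmulr_lge0.
Qed.

(** Write [f t] as [(f t / |t|) * |t|]. For [t > 0] both factors are nonnegative and nondecreasing;
    for [t < 0] the first is nonpositive and nondecreasing while [|t|] decreases. The sign condition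
    links the two half-lines. *)
Lemma f_nondecreasing : {homo f : s t / s <= t}.
Proof.
move=> s t st.
have [s0|s0] := leP s 0.
  have [t0|t0] := leP 0 t; first by apply: le_trans (f_le0 s0) (f_ge0 t0).
  have s0' : s < 0 by exact: le_lt_trans t0.
  have := cf2.2 s t (ltr0_neq0 s0') (ltr0_neq0 t0) st.
  rewrite (ltr0_norm s0') (ltr0_norm t0) => H.
  have ft := f_le0 (ltW t0).
  have : f s / - s * - s <= f t / - t * - s by rewrite ler_wpM2r// oppr_ge0.
  rewrite divfK ?oppr_eq0 ?ltr0_neq0// => /le_trans; apply.
  rewrite mulrAC -mulrA ler_neMr// ler_pdivlMr ?oppr_gt0// mul1r lerN2.
  by [].
have t0 : 0 < t by exact: lt_le_trans st.
have := cf2.2 s t (lt0r_neq0 s0) (lt0r_neq0 t0) st.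
rewrite (gtr0_norm s0) (gtr0_norm t0) => H.
have : f s / s * s <= f t / t * s by rewrite ler_wpM2r// ltW.
rewrite divfK ?lt0r_neq0// => /le_trans; apply.
rewrite mulrAC -mulrA ler_piMr ?f_ge0 ?(ltW t0)// ler_pdivrMr// mul1r//.
Qed.

Lemma f_scale_le (c a : R) : 0 < c <= 1 -> f (c * a) * a <= c * (f a * a).
Proof.
move=> /andP[c0 c1]; have [a0|a0|->] := ltgtP a 0; last by rewrite !mulr0.
- have ca0 : c * a < 0 by rewrite nmulr_llt0.
  have := cf2.2 a (c * a) (ltr0_neq0 a0) (ltr0_neq0 ca0).
  rewrite (ltr0_norm a0) (ltr0_norm ca0) => /(_ _) H.
  have : a <= c * a by rewrite -[leLHS]mul1r ler_wnM2r// ltW.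
  move=> /H; rewrite ler_pdivlMr ?oppr_gt0// => H'.
  rewrite mulrA ler_wnM2r ?(ltW a0)//.
  apply: le_trans H'; rewrite le_eqVlt; apply/orP; left; apply/eqP.
  by field; rewrite ltr0_neq0.
- have ca0 : 0 < c * a by rewrite mulr_gt0.
  have := cf2.2 (c * a) a (lt0r_neq0 ca0) (lt0r_neq0 a0).
  rewrite (gtr0_norm a0) (gtr0_norm ca0) => /(_ _) H.
  have : c * a <= a by rewrite -[leRHS]mul1r ler_wpM2r// ltW.
  move=> /H; rewrite ler_pdivrMr// => H'.
  rewrite mulrA ler_wpM2r ?(ltW a0)//.
  apply: (le_trans H'); rewrite le_eqVlt; apply/orP; left; apply/eqP.
  by field; rewrite lt0r_neq0.
Qed.

Lemma primitive_convex (a b : R) : primitive f b - primitive f a <= f b * (b - a).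
Proof.
have [ab|ba|->] := ltgtP a b; last by rewrite !subrr mulr0.
  have [c] := primitive_MVT ab; rewrite in_itv/= => /andP[ac cb] ->.
  by rewrite ler_wpM2r ?subr_ge0 ?(ltW ab)// f_nondecreasing// ltW.
have [c] := primitive_MVT ba; rewrite in_itv/= => /andP[bc ca] E.
rewrite -opprB E -[b - a]opprB mulrN lerN2.
by rewrite ler_wpM2r ?subr_ge0 ?(ltW ba)// f_nondecreasing// ltW.
Qed.

Lemma primitive_ge0 t : 0 <= primitive f t.
Proof.
by have := primitive_convex t 0; rewrite primitive0 f0 mul0r sub0r oppr_le0.
Qed.

Lemma primitive_le t : primitive f t <= f t * t.
Proof. by have := primitive_convex 0 t; rewrite primitive0 !subr0. Qed.

(** The function [g s = s^2 / 2 * f(a) a - F(s a)] has derivative [s f(a) a - f(s a) a], which is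
    nonnegative on []0, 1]] by [f_scale_le]; the claim is [g t <= g 1]. *)
Lemma primitive_scale_le (t a : R) : 0 <= t <= 1 ->
  primitive f a - primitive f (t * a) <= (1 - t ^+ 2) / 2 * (f a * a).
Proof.
move=> /andP[t0 t1].
have [->|] := eqVneq t 1; first by rewrite mul1r subrr expr1n subrr !mul0r.
move=> tN1; have {}t1 : t < 1 by rewrite lt_neqAle tN1.
pose g s := 2^-1 * (f a * a) * s ^+ 2 - primitive f (s * a).
pose g' s := f a * a * s - f (s * a) * a.
have dg (s : R) : is_derive s (1 : R) g (g' s).
  have d1 : is_derive s (1 : R) (fun s : R => s * a) a.
    have := is_deriveM (is_derive_id s 1) (is_derive_cst (a : R) s 1).
    by rewrite /GRing.scale/= mulr0 add0r mulr1.
  have d2 := @is_derive1_comp R (primitive f) (fun s => s * a) s _ _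
    (is_derive_primitive (s * a)) d1.
  have d3 : is_derive s (1 : R) (fun s : R => 2^-1 * (f a * a) * s ^+ 2) (f a * a * s).
    have := is_deriveM (is_derive_cst (2^-1 * (f a * a) : R) s 1)
      (is_deriveM (is_derive_id s 1) (is_derive_id s 1)).
    rewrite /GRing.scale/= mulr0 addr0 mulr1.
    have -> : 2^-1 * (f a * a) * (s + s) = f a * a * s by field.
    by under [X in _ -> is_derive _ _ X _]eq_fun do rewrite expr2.
  exact: (is_deriveB d3 d2).
have cg : {within `[t, 1], continuous g}.
  by apply: derivable_within_continuous => x _; have [] := dg x.
have [c] := @MVT R g g' t 1 t1 (fun x _ => dg x) cg.
rewrite in_itv/= => /andP[tc c1] E.
have : 0 <= g 1 - g t.
  rewrite E mulr_ge0 ?subr_ge0//; last exact: ltW.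
  rewrite [leRHS]mulrC f_scale_le// (le_lt_trans t0)//=; exact: ltW.
rewrite /g expr1n !mul1r; lra.
Qed.

End primitive_theory.

(** * Differentiability, rays and lower semicontinuity of the energy *)

Section energy_theory.
Context {R : realType} {n : nat}.
Variable Omega : set 'rV[R]_n.+1.
Hypotheses (oO : open Omega) (bO : bounded_set Omega).
Local Notation leb := (@lebesgue_rV R n.+1).
Implicit Types (u v w d : @sobolev R n.+1) (g h : 'rV[R]_n.+1 -> R).

Let mO : measurable Omega. Proof. exact: open_measurable_rV. Qed.
Let finO : (leb Omega < +oo)%E. Proof. exact: bounded_lebesgue_rV_lty. Qed.

Variables (p : R) (f : R -> R) (c : R).
Hypotheses (p2 : 2 < p) (c0 : 0 <= c) (cf : continuous f) (f0 : f 0 = 0).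
Hypothesis cf2 : cond_f2 f.
Hypothesis fgrow : forall t, `|f t| <= c * (1 + `|t| `^ (p - 1)).

Local Notation Lp := (Lp Omega p).
Local Notation F := (primitive f).

Let p0 : 0 < p. Proof. by apply: lt_trans p2. Qed.

Let p1 : 0 < p - 1. Proof. by rewrite subr_gt0; apply: lt_trans p2; rewrite ltr1n. Qed.

Lemma Lp_addZ g h (t : R) : Lp g -> Lp h -> Lp (fun x => g x + t * h x).
Proof.
move=> [mg ig] [mh ih].
have mgh : measurable_fun Omega (fun x => g x + t * h x).
  by apply: measurable_funD => //; exact: measurable_funM.
split => //.
apply: (integrable_le oO (g := fun x => 2 `^ p * `|g x| `^ p + (2 `^ p * `|t| `^ p) *
  `|h x| `^ p)).
- exact: measurable_norm_powR.
- by apply: integrable_addZ => //; exact: (integrableZl mO (2 `^ p) ig).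
- move=> x _; rewrite ger0_norm ?powR_ge0//.
  apply: (@le_trans _ _ ((`|g x| + `|t| * `|h x|) `^ p)).
    rewrite ge0_ler_powR ?nnegrE ?addr_ge0 ?mulr_ge0 ?(ltW p0)//.
    by rewrite -normrM ler_normD.
  apply: le_trans (powRD_le _ _ (ltW p0)) _; rewrite ?mulr_ge0//.
  by rewrite powRM// mulrDr mulrA.
Qed.

(** According to whether [b <= e * a] or not, one of the two terms alone suffices. *)
Lemma young_powR (e a b : R) : 0 < e -> 0 <= a -> 0 <= b ->
  a `^ (p - 1) * b <= e * a `^ p + e^-1 `^ (p - 1) * b `^ p.
Proof.
move=> e0 a0 b0.
have ei : 0 <= e^-1 by rewrite invr_ge0 ltW.
have [bea|eab] := leP b (e * a).
  apply: ler_wpDr; first by rewrite mulr_ge0 ?powR_ge0.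
  rewrite -(mulr_powRB1 a0 p0) mulrA [leRHS]mulrC.
  by apply: ler_wpM2l => //; exact: powR_ge0.
apply: ler_wpDl; first by rewrite mulr_ge0 ?powR_ge0// ltW.
rewrite -(mulr_powRB1 b0 p0) mulrCA -powRM// [leLHS]mulrC.
apply: ler_wpM2l => //; apply: ge0_ler_powR; rewrite ?nnegrE ?(ltW p1) ?mulr_ge0//.
by rewrite ler_pdivlMl// ltW.
Qed.

(** With [e = 1] this dominates [f(g) h]; with [e] small it keeps the coefficient of [|a| ^ p]
    small, as [energy_lsc] requires. *)
Lemma norm_f_mul_le (e a b : R) : 0 < e ->
  `|f a * b| <= c * (e * (1 + `|a| `^ p) + 2 * e^-1 `^ (p - 1) * `|b| `^ p).
Proof.
move=> e0; rewrite normrM.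
apply: (@le_trans _ _ (c * (1 + `|a| `^ (p - 1)) * `|b|)); first by rewrite ler_wpM2r.
rewrite -mulrA; apply: ler_wpM2l => //.
have h1 := young_powR e0 ler01 (normr_ge0 b).
rewrite powR1/= mul1r mulr1 in h1.
have h2 := young_powR e0 (normr_ge0 a) (normr_ge0 b).
rewrite mulrDl mul1r; move: h1 h2; lra.
Qed.

Lemma integrable_norm_f_mul_bound (e : R) g h : Lp g -> Lp h ->
  leb.-integrable Omega (EFin \o (fun x =>
    c * (e * (1 + `|g x| `^ p) + 2 * e^-1 `^ (p - 1) * `|h x| `^ p))).
Proof.
move=> [mg ig] [mh ih].
have i1 := integrable_addZ oO 1 (integrable_cst_Omega oO bO 1) ig.
have i2 := integrableZl mO e i1.
have i3 := integrable_addZ oO (2 * e^-1 `^ (p - 1)) i2 ih.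
have i4 := integrableZl mO c i3.
apply: eq_integrable i4 => // x _ /=.
by rewrite -!EFinM; congr EFin; rewrite mul1r.
Qed.

Lemma measurable_continuous_comp (k : R -> R) g : continuous k -> measurable_fun Omega g ->
  measurable_fun Omega (k \o g).
Proof.
move=> ck mg; apply: (measurableT_comp _ mg).
exact: continuous_measurable_fun.
Qed.

Lemma integrable_f_mul g h : Lp g -> Lp h ->
  leb.-integrable Omega (EFin \o (fun x => f (g x) * h x)).
Proof.
move=> lg lh; apply: (integrable_le oO _ (integrable_norm_f_mul_bound 1 lg lh)).
  apply: measurable_funM; last exact: lh.1.
  by apply: measurable_continuous_comp => //; exact: lg.1.
by move=> x _; exact: norm_f_mul_le.
Qed.

Lemma integrable_primitive g : Lp g -> leb.-integrable Omega (EFin \o (fun x => F (g x))).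
Proof.
move=> lg; apply: (integrable_le oO _ (integrable_f_mul lg lg)).
  apply: measurable_continuous_comp; last exact: lg.1.
  exact: continuous_primitive.
move=> x _; rewrite ger0_norm; first exact: primitive_le.
exact: primitive_ge0.
Qed.

(** By monotonicity [f (a + s * b)] lies between the values of [f] at [a - |b|] and [a + |b|]. The
    resulting bound is free of [s], hence usable as a dominating function. *)
Lemma norm_f_between (a b s : R) : `|s| <= 1 ->
  `|f (a + s * b)| <= `|f (a + b)| + `|f (a - b)|.
Proof.
move=> s1; have fh := f_nondecreasing f0 cf2.
have sb : - `|b| <= s * b <= `|b|.
  by rewrite -ler_norml normrM ler_piMl.
have [l1 l2] : f (a - `|b|) <= f (a + s * b) /\ f (a + s * b) <= f (a + `|b|).
  by case/andP: sb => ? ?; split; apply: fh; rewrite lerD2l.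
have : `|f (a + `|b|)| + `|f (a - `|b|)| = `|f (a + b)| + `|f (a - b)|.
  by have [b0|b0] := leP 0 b; [rewrite (ger0_norm b0)|rewrite (ltr0_norm b0) opprK addrC].
move=> <-; rewrite ler_norml; apply/andP; split.
  have := ler_norm (- f (a - `|b|)); rewrite normrN; have := normr_ge0 (f (a + `|b|)); lra.
have := ler_norm (f (a + `|b|)); have := normr_ge0 (f (a - `|b|)); lra.
Qed.

Lemma is_derive_integral_primitive g h (t : R) : Lp g -> Lp h ->
  is_derive t (1 : R) (fun s => \int[leb]_(x in Omega) F (g x + s * h x))
    (\int[leb]_(x in Omega) (f (g x + t * h x) * h x)).
Proof.
move=> lg lh.
pose Ft (s : R) x := F (g x + s * h x).
have dF x (s : R) : is_derive s (1 : R) (Ft ^~ x) (f (g x + s * h x) * h x).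
  have d1 : is_derive s (1 : R) (fun s : R => g x + s * h x) (h x).
    have := is_deriveD (is_derive_cst (g x : R) s 1) (is_deriveM (is_derive_id s 1)
      (is_derive_cst (h x : R) s 1)).
    by rewrite /GRing.scale/= mulr0 !add0r mulr1.
  exact: (@is_derive1_comp R F (fun s => g x + s * h x) s _ _ (is_derive_primitive cf _) d1).
have d1F s x : partial1of2 Ft s x = f (g x + s * h x) * h x.
  by rewrite partial1of2E; have [_ ->] := dF x s.
(* Dominates the derivative in [s] on the whole interval []t - 1, t + 1[]. *)
pose G x := (`|f (g x + t * h x + h x)| + `|f (g x + t * h x - h x)|) * `|h x|.
have tI : `]t - 1, t + 1[%classic t by rewrite /= in_itv/=; apply/andP; split; lra.
have intF s : `]t - 1, t + 1[%classic s -> leb.-integrable Omega (EFin \o Ft s).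
  by move=> _; apply: integrable_primitive; exact: Lp_addZ.
have G0 x : 0 <= G x by rewrite mulr_ge0// addr_ge0.
have iG : leb.-integrable Omega (EFin \o G).
  have lt' := Lp_addZ t lg lh.
  have l1 := integrable_f_mul (Lp_addZ 1 lt' lh) lh.
  have l2 := integrable_f_mul (Lp_addZ (-1) lt' lh) lh.
  have n1 := integrable_norm l1; have n2 := integrable_norm l2.
  have i12 := integrable_addZ oO 1 n1 n2.
  apply: eq_integrable i12 => // x _ /=; congr EFin.
  by rewrite /G mulrDl !normrM !mul1r mulN1r.
have G_ub s x : `]t - 1, t + 1[%classic s -> Omega x -> `|partial1of2 Ft s x| <= G x.
  move=> ts _; rewrite d1F normrM ler_wpM2r//.
  have -> : g x + s * h x = g x + t * h x + (s - t) * h x by ring.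
  apply: norm_f_between; rewrite ler_norml.
  by move: ts; rewrite /= in_itv/= => /andP[? ?]; apply/andP; split; lra.
have dFt s x : `]t - 1, t + 1[%classic s -> Omega x -> derivable (Ft ^~ x) s 1.
  by move=> _ _; have [] := dF x s.
have D := derivable_under_integral mO tI intF dFt G0 iG G_ub.
have E := differentiation_under_integral mO tI intF dFt G0 iG G_ub.
apply: DeriveDef; first exact: D.
rewrite -derive1E E; apply: eq_Rintegral => x _; exact: d1F.
Qed.

(** At [t = 0] this evaluates [<E'(u), v>]; a general [t] is allowed because continuity of [E] along
    rays is deduced from it. *)
Lemma is_derive_energy u v (t : R) : L2pair Omega u -> L2pair Omega v -> Lp u.1 -> Lp v.1 ->
  is_derive t (1 : R) (fun s => energy Omega f (u + s *: v))
    (H10dot Omega u v + t * H10dot Omega v v -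
     \int[leb]_(x in Omega) (f (u.1 x + t * v.1 x) * v.1 x)).
Proof.
move=> pu pv lu lv.
set a := H10dot Omega u v; set b := H10dot Omega v v; set q := H10dot Omega u u.
pose q1 (s : R) := 2^-1 * q + s * (a + 2^-1 * b * s).
pose I1 (s : R) := \int[leb]_(x in Omega) F (u.1 x + s * v.1 x).
have -> : (fun s => energy Omega f (u + s *: v)) = q1 - I1.
  apply/funext => s; transitivity (q1 s - I1 s); last by [].
  rewrite /energy H10norm_sqr H10dot_expand// -/a -/b -/q.
  by congr (_ - _); rewrite /q1; field.
apply: is_deriveB; last exact: is_derive_integral_primitive.
have := is_deriveD (is_derive_cst (2^-1 * q : R) t 1) (is_deriveM (is_derive_id t 1)
  (is_deriveD (is_derive_cst (a : R) t 1) (is_deriveM (is_derive_cst (2^-1 * b : R) t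
    1) (is_derive_id t 1)))).
rewrite /GRing.scale/= !mulr0 !mulr1 !add0r addr0.
by have -> : t * (2^-1 * b) + (a + 2^-1 * b * t) = a + t * b by field.
Qed.

(** Integrating [primitive_scale_le] bounds [E(w) - E(t w)] from below by [(1 - t^2) / 2] times the
    difference of the two sides of the last hypothesis. *)
Lemma energy_ray w (t : R) : L2pair Omega w -> Lp w.1 -> 0 <= t <= 1 ->
  \int[leb]_(x in Omega) (f (w.1 x) * w.1 x) <= H10dot Omega w w ->
  energy Omega f (t *: w) <= energy Omega f w.
Proof.
move=> pw lw t01 hw.
have E : t *: w = w + (t - 1) *: w by rewrite scalerBl scale1r addrC subrK.
have ltw : Lp (t *: w).1 by rewrite E; exact: Lp_addZ.
have HE : H10dot Omega (t *: w) (t *: w) = t ^+ 2 * H10dot Omega w w.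
  by rewrite E H10dot_expand//; ring.
have iF := integrable_primitive lw; have iFt := integrable_primitive ltw.
have ifw := integrable_f_mul lw lw.
rewrite /energy !H10norm_sqr HE.
have : \int[leb]_(x in Omega) F (w.1 x) - \int[leb]_(x in Omega) F ((t *: w).1 x) <=
    (1 - t ^+ 2) / 2 * \int[leb]_(x in Omega) (f (w.1 x) * w.1 x).
  rewrite -RintegralB// -RintegralZl//; apply: le_Rintegral => //.
  - exact: (integrableB mO iF iFt).
  - exact: (integrableZl mO _ ifw).
  - by move=> x _; exact: primitive_scale_le.
have t2 : 0 <= (1 - t ^+ 2) / 2.
  by case/andP: t01 => ? ?; rewrite divr_ge0// subr_ge0 exprn_ile1.
move: (ler_wpM2l t2 hw) => hw'; move: hw'.
move: (\int[leb]_(x in Omega) F (w.1 x)) (\int[leb]_(x in Omega) F ((t *: w).1 x))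
  (\int[leb]_(x in Omega) (f (w.1 x) * w.1 x)) (H10dot Omega w w) => I1 I2 I3 H.
by lra.
Qed.

(** A quantitative lower semicontinuity at [u]: [K] depends on [u] only and multiplies the free
    parameter [e], while the [e]-dependent [K'] multiplies quantities that tend to 0 with [d].
    Convexity of [F] is used with the tangent at [u + d]. *)
Lemma energy_lsc u : L2pair Omega u -> Lp u.1 ->
  exists2 K, 0 <= K & forall e, 0 < e -> exists2 K', 0 <= K' &
    forall d, L2pair Omega d -> Lp d.1 ->
      energy Omega f u <= energy Omega f (u + 1 *: d) + e * K +
        K' * (H10dot Omega d d + \int[leb]_(x in Omega) (`|d.1 x| `^ p)).
Proof.
move=> pu lu.
pose U := H10dot Omega u u; pose P := \int[leb]_(x in Omega) (`|u.1 x| `^ p).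
pose m := fine (leb Omega).
have U0 : 0 <= U by exact: H10dot_ge0.
have P0 : 0 <= P by apply: Rintegral_ge0 => x _; exact: powR_ge0.
have m0 : 0 <= m by exact: fine_ge0.
exists (U + c * (m + 2 `^ p * P)).
  by rewrite addr_ge0// mulr_ge0// addr_ge0// mulr_ge0// powR_ge0.
move=> e e0; have ei : 0 < e^-1 by rewrite invr_gt0.
pose L := c * (e * 2 `^ p + 2 * e^-1 `^ (p - 1)).
have L0 : 0 <= L by rewrite mulr_ge0// addr_ge0// mulr_ge0 ?powR_ge0// ltW.
exists (e^-1 + L); first by rewrite addr_ge0// ltW.
move=> d pd ld.
pose D := H10dot Omega d d; pose Q := \int[leb]_(x in Omega) (`|d.1 x| `^ p).
have D0 : 0 <= D by exact: H10dot_ge0.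
have Q0 : 0 <= Q by apply: Rintegral_ge0 => x _; exact: powR_ge0.
have lud : Lp (u + 1 *: d).1 by exact: Lp_addZ.
have iF := integrable_primitive lu; have iFd := integrable_primitive lud.
(* From the nonnegativity of the quadratic form at [u + e^-1 *: d], multiplied by [e]. *)
have quad : - H10dot Omega u d <= e * U + e^-1 * D.
  have := H10dot_ge0 Omega (u + e^-1 *: d); rewrite H10dot_expand// -/U -/D.
  move=> H; have : 0 <= e * (U + 2 * e^-1 * H10dot Omega u d + e^-1 ^+ 2 * D) by
    rewrite mulr_ge0// ltW.
  have -> : e * (U + 2 * e^-1 * H10dot Omega u d + e^-1 ^+ 2 * D) = e * U + 2 * H10dot
    Omega u d + e^-1 * D.
    by field; rewrite gt_eqF.
  have : 0 <= e * U by rewrite mulr_ge0// ltW.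
  have : 0 <= e^-1 * D by rewrite mulr_ge0// ltW.
  lra.
have FF : \int[leb]_(x in Omega) F ((u + 1 *: d).1 x) - \int[leb]_(x in Omega) F (u.1 x) <=
    e * (c * (m + 2 `^ p * P)) + L * Q.
  have [_ iu] := lu; have [_ id_] := ld.
  have ic := integrable_cst_Omega oO bO (1 : R).
  have i1 := integrable_addZ oO (2 `^ p) ic iu.
  have i2 := integrableZl mO (e * c) i1.
  have -> : e * (c * (m + 2 `^ p * P)) + L * Q =
      \int[leb]_(x in Omega) (e * c * (1 + 2 `^ p * `|u.1 x| `^ p) + L * `|d.1 x| `^ p).
    rewrite Rintegral_addZ// RintegralZl// Rintegral_addZ// Rintegral_cst// mul1r.
    by rewrite mulrA.
  rewrite -RintegralB//; apply: le_Rintegral => //.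
  - exact: (integrableB mO iFd iF).
  - exact: integrable_addZ.
  move=> x _; apply: le_trans (primitive_convex cf f0 cf2 _ _) _.
  rewrite sobolev_fst mul1r addrAC subrr add0r.
  apply: le_trans (ler_norm _) _; apply: le_trans (norm_f_mul_le _ _ e0) _.
  have : `|u.1 x + d.1 x| `^ p <= 2 `^ p * (`|u.1 x| `^ p + `|d.1 x| `^ p).
    apply: le_trans (powRD_le _ _ (ltW p0)) => //.
    by rewrite ge0_ler_powR ?nnegrE ?addr_ge0 ?(ltW p0)// ler_normD.
  set X := `|u.1 x + d.1 x| `^ p; set A := `|u.1 x| `^ p; set B := `|d.1 x| `^ p.
  move=> XAB; rewrite /L.
  have -> : e * c * (1 + 2 `^ p * A) + c * (e * 2 `^ p + 2 * e^-1 `^ (p - 1)) * B =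
     c * (e * (1 + 2 `^ p * (A + B)) + 2 * e^-1 `^ (p - 1) * B) by ring.
  by rewrite ler_wpM2l// lerD2r ler_pM2l// lerD2l.
rewrite /energy !H10norm_sqr H10dot_expand// -/U -/D -/Q.
have LD : 0 <= L * D by exact: mulr_ge0.
have eQ : 0 <= e^-1 * Q by rewrite mulr_ge0// ltW.
move: quad FF LD eQ; rewrite expr1n mul1r mulr1 !mulrDl !mulrDr.
move: (\int[leb]_(x in Omega) F (u.1 x)) (\int[leb]_(x in Omega) F ((u + 1 *: d).1 x))
  (H10dot Omega u d) => I1 I2 H.
clearbody D U; move: (L * Q) (L * D) (e^-1 * Q) (e^-1 * D) (e * U) => a1 a2 a3 a4 a5.
by lra.
Qed.

End energy_theory.

(** * The perturbed problem *)

Section perturbation.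
Context {R : realType}.
Implicit Types r s : R.

Lemma pert_ge0 r s : s < 1 -> 0 <= pert r s.
Proof. by move=> s1; rewrite divr_ge0 ?powR_ge0// subr_ge0 ltW. Qed.

Lemma is_derive_pert r s : 0 < s < 1 ->
  is_derive s (1 : R) (pert r) (s `^ (r - 1) * (r * (1 - s) + s) / (1 - s) ^+ 2).
Proof.
move=> /andP[s0 s1]; have s1' : 1 - s != 0 by rewrite subr_eq0 gt_eqF.
have d1 : is_derive s (1 : R) (fun x : R => 1 - x) (0 - 1).
  exact: (is_deriveB (is_derive_cst (1 : R) s 1) (is_derive_id s 1)).
have d2 := is_deriveM (is_derive1_powR r s0) (@is_deriveV R _ s _ _ s1' d1).
have : is_derive s (1 : R) (fun x : R => x `^ r * (1 - x)^-1)
    (s `^ (r - 1) * (r * (1 - s) + s) / (1 - s) ^+ 2).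
  apply: (is_derive_eq d2); rewrite /GRing.scale/= sub0r mulrN1 opprK.
  have -> : s `^ r = s * s `^ (r - 1).
    by rewrite -[X in X * _]powRr1 ?ltW// -powRD addrC ?subrK// (gt_eqF s0) implybT.
  by field.
apply: near_eq_is_derive; near=> x.
have x0 : 0 < x by near: x; exact: lt_nbhsr.
by rewrite /pert ger0_norm// ltW.
Unshelve. all: by end_near. Qed.

(** For [s > 0] the derivative is at least [r s^(r-1) / (1 - s)], and [s^(r-1) >= s^r]. At [s = 0]
    the left-hand side is [0], and the absolute value makes the bound hold without computing the
    derivative there. *)
Lemma pert_le_derive r s : 1 < r -> 0 <= s < 1 ->
  pert r s <= `|derive1 (pert r) s| / r.
Proof.
move=> r1 /andP[s0 s1]; have r0 : 0 < r by exact: lt_trans r1.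
move: s0; rewrite le_eqVlt => /orP[/eqP <-|s0].
  by rewrite {1}/pert normr0 powR0 ?gt_eqF// mul0r divr_ge0// ltW.
have s01 : 0 < s < 1 by rewrite s0.
rewrite derive1E (@derive_val _ _ _ _ _ _ _ (is_derive_pert r s01)).
have t0 : 0 < 1 - s by rewrite subr_gt0.
rewrite ger0_norm; last first.
  by rewrite divr_ge0 ?exprn_ge0 ?(ltW t0)// mulr_ge0 ?powR_ge0// addr_ge0 ?(ltW s0)//
    mulr_ge0// ltW.
rewrite ler_pdivlMr// /pert (gtr0_norm s0).
have -> : s `^ r = s * s `^ (r - 1) by rewrite mulr_powRB1// ltW.
have -> : s * s `^ (r - 1) / (1 - s) * r = s `^ (r - 1) * (s * r * (1 - s)) / (1 - s) ^+ 2.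
  by field; rewrite gt_eqF.
apply: ler_wpM2r; first by rewrite invr_ge0 exprn_ge0// ltW.
apply: ler_wpM2l; first exact: powR_ge0.
apply: ler_wpDr; first exact: ltW.
by rewrite -mulrA ler_piMl ?(ltW s1)// mulr_ge0 ?ltW.
Qed.

Lemma continuous_pert r s : 1 < r -> 0 <= s < 1 -> {for s, continuous (pert r)}.
Proof.
move=> r1 /andP[]; rewrite le_eqVlt => /orP[/eqP <- _|s0 s1]; last first.
  apply: differentiable_continuous; apply/derivable1_diffP.
  by have [] := is_derive_pert r (introT andP (conj s0 s1)).
have p0 : pert r 0 = 0.
  by rewrite /pert normr0 powR0 ?mul0r// gt_eqF// (lt_trans _ r1).
rewrite /prop_for /continuous_at p0; apply/cvgrPdist_le => e e0.
have N1 : \forall x \near (0 : R), ball (0 : R) 2^-1 x.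
  by apply: nbhsx_ballx; rewrite invr_gt0.
have N2 : \forall x \near (0 : R), ball (0 : R) (e / 2) x.
  by apply: nbhsx_ballx; rewrite divr_gt0.
near=> x.
have x2 : `|x| < 2^-1 by have := near N1 x; rewrite /ball/= sub0r normrN; apply.
have xe : `|x| < e / 2 by have := near N2 x; rewrite /ball/= sub0r normrN; apply.
have x1 : 2^-1 <= 1 - x by have := ler_norm x; lra.
rewrite sub0r normrN ger0_norm; last by apply: pert_ge0; lra.
rewrite /pert ler_pdivrMr; last by lra.
apply: (@le_trans _ _ `|x|); last by have := ltW e0; nra.
have [->|xN0] := eqVneq x 0.
  by rewrite normr0 powR0// gt_eqF// (lt_trans _ r1).
rewrite ge1r_powR ?normr_gt0 ?xN0//= ?ltW//.
Unshelve. all: by end_near. Qed.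

Lemma pert_unbounded r (M : R) : 0 < r -> 0 <= M ->
  exists2 s, 0 < s < 1 & M < pert r s.
Proof.
(* The witness is [1 - d]: [d <= 1 / 2] keeps the numerator at least [q], and [d <= q / (M + 1)]
   makes the quotient at least [M + 1]. *)
move=> r0 M0; pose q : R := 2^-1 `^ r.
have q0 : 0 < q by rewrite powR_gt0.
pose d := Num.min 2^-1 (q / (M + 1)).
have M1 : 0 < M + 1 by rewrite ltr_wpDl.
have d0 : 0 < d by rewrite lt_min invr_gt0 ltr0n/= divr_gt0.
have d2 : d <= 2^-1 by rewrite ge_min lexx.
have dq : d <= q / (M + 1) by rewrite ge_min lexx orbT.
exists (1 - d); first by apply/andP; split; lra.
rewrite /pert subKr ger0_norm; last lra.
rewrite ltr_pdivlMr//.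
apply: (@lt_le_trans _ _ q).
  apply: (@lt_le_trans _ _ ((M + 1) * d)); first by rewrite ltr_pM2r// ltrDl.
  by rewrite mulrC -ler_pdivlMr.
have d12 : 2^-1 <= 1 - d by lra.
by apply: ge0_ler_powR; rewrite ?nnegrE ?(ltW r0) ?invr_ge0// (le_trans _ d12)// invr_ge0.
Qed.

End perturbation.

(** * Comparing the mountain-pass levels with the energy on [Nplus] *)

Section mountain_pass.
Context {R : realType} {n : nat}.
Variable Omega : set 'rV[R]_n.+1.
Hypotheses (oO : open Omega) (bO : bounded_set Omega).
Local Notation leb := (@lebesgue_rV R n.+1).
Implicit Types (u v w d : @sobolev R n.+1).

Variables (p : R) (f : R -> R) (c : R).
Hypotheses (p2 : 2 < p) (pcrit : (p%:E < @critical_exponent R n.+1)%E).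
Hypotheses (c0 : 0 <= c) (cf : continuous f) (f0 : f 0 = 0) (cf2 : cond_f2 f).
Hypothesis fgrow : forall t, `|f t| <= c * (1 + `|t| `^ (p - 1)).

Local Notation E := (energy Omega f).

Lemma H10_Lp u : H10 Omega u -> Lp Omega p u.1.
Proof.
move=> hu; have [C _ HC] := sobolev_H10 oO bO p2 pcrit.
pose G := 1 + H10dot Omega u u.
have H0 := H10dot_ge0 Omega u.
have G0 : 0 < G by rewrite ltr_pwDl.
suff : H10dot Omega u u <= G ^+ 2 by move=> /(HC u G hu G0)[].
by rewrite /G; move: (H10dot Omega u u) H0 => x x0; nra.
Qed.

Lemma L2norm_scale w (t : R) : H10 Omega w ->
  L2norm Omega (t *: w) ^+ 2 = t ^+ 2 * L2dot Omega w w.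
Proof.
move=> /H10_L2pair pw; rewrite L2norm_sqr.
have -> : t *: w = w + (t - 1) *: w by rewrite scalerBl scale1r addrC subrK.
by rewrite L2dot_expand//; ring.
Qed.

Lemma H10norm_scale w (t : R) : H10 Omega w ->
  H10norm Omega (t *: w) = `|t| * H10norm Omega w.
Proof.
move=> /H10_L2pair pw; rewrite /H10norm.
have -> : t *: w = w + (t - 1) *: w by rewrite scalerBl scale1r addrC subrK.
rewrite H10dot_expand//.
have -> : H10dot Omega w w + 2 * (t - 1) * H10dot Omega w w + (t - 1) ^+ 2 * H10dot Omega w w =
  t ^+ 2 * H10dot Omega w w by ring.
by rewrite sqrtrM ?sqr_ge0// sqrtr_sqr.
Qed.

Lemma continuous_energy_ray w : H10 Omega w -> continuous (fun t : R => E (t *: w)).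
Proof.
move=> hw; have pw := H10_L2pair hw; have lw := H10_Lp hw.
pose h (s : R) := E (w + s *: w).
have ch : continuous h.
  move=> s; apply: differentiable_continuous; apply/derivable1_diffP.
  by have [] := is_derive_energy oO bO p2 c0 cf f0 cf2 fgrow s pw pw lw lw.
have -> : (fun t : R => E (t *: w)) = h \o (fun t => t - 1).
  by apply/funext => t; rewrite /h/= scalerBl scale1r addrC subrK.
move=> t; apply: continuous_comp; last exact: ch.
by apply: continuousB; [exact: cvg_id|exact: cvg_cst].
Qed.

Lemma mp_level_le (r mu : R) w : 1 < r -> 0 < mu -> H10 Omega w -> L2dot Omega w w = mu ->
  \int[leb]_(x in Omega) (f (w.1 x) * w.1 x) <= H10dot Omega w w ->
  (mp_level Omega f r mu <= (E w)%:E)%E.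
Proof.
move=> r1 mu0 hw wmu hN; have pw := H10_L2pair hw; have lw := H10_Lp hw.
have ray t : 0 <= t <= 1 -> E (t *: w) <= E w.
  by move=> t01; apply: (energy_ray oO bO p2 c0 cf f0 cf2 fgrow) => //.
have E0 : E 0 = 0.
  rewrite /energy /H10norm.
  have -> : H10dot Omega (0 : sobolev) (0 : sobolev) = 0.
    rewrite (_ : 0 = w + (- 1) *: w); last by rewrite scaleN1r subrr.
    by rewrite H10dot_expand//; ring.
  rewrite sqrtr0 expr0n/= mul0r sub0r; apply/eqP; rewrite oppr_eq0; apply/eqP.
  rewrite (_ : (fun _ => _) = fun=> 0) ?Rintegral_cst ?mul0r//; first exact:
    open_measurable_rV.
  by apply/funext => x /=; rewrite primitive0.
have Ew0 : 0 <= E w by rewrite -E0 -(scale0r w); apply: ray; rewrite lexx ler01.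
have r0 : 0 < r by exact: lt_trans r1.
(* At mass ratio [s < 1] the perturbation already exceeds [E w], so the path ends at negative energy
   inside the ball. The ratio at time [t] is [t ^+ 2 * s], whence [t0 = sqrt s]. *)
have [s /andP[s0 s1] sE] := pert_unbounded r0 Ew0.
pose t0 := Num.sqrt s.
have t00 : 0 <= t0 by exact: sqrtr_ge0.
have t02 : t0 ^+ 2 = s by rewrite sqr_sqrtr// ltW.
have t01 : t0 <= 1 by rewrite -(@expr_le1 _ 2)// t02 ltW.
pose g (t : R) := (t * t0) *: w.
have gL2 t : L2norm Omega (g t) ^+ 2 / mu = t ^+ 2 * s.
  by rewrite L2norm_scale// wmu mulfK ?gt_eqF// exprMn t02.
have t2s t : t \in `[0, 1] -> 0 <= t ^+ 2 * s < 1.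
  rewrite in_itv/= => /andP[tge0 tle1]; rewrite mulr_ge0 ?sqr_ge0 ?(ltW s0)//=.
  by apply: le_lt_trans s1; rewrite ler_piMl ?(ltW s0)// exprn_ile1.
have tt0 t : t \in `[0, 1] -> 0 <= t * t0 <= 1.
  by rewrite in_itv/= => /andP[tge0 tle1]; rewrite mulr_ge0//= mulr_ile1.
have Eg t : t \in `[0, 1] -> energy_pert Omega f r mu (g t) <= E w.
  move=> tI; apply: (@le_trans _ _ (E (g t))); last exact/ray/tt0.
  by rewrite gerBl gL2; apply: pert_ge0; case/andP: (t2s _ tI).
have path : mp_path Omega f r mu g.
  split.
  - move=> t tI; split; first exact: H10_scale.
    by rewrite -(@ltr_pM2r _ mu^-1) ?invr_gt0// gL2 mulfV ?gt_eqF//; case/andP: (t2s _ tI).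
  - move=> t tI; apply/cvgrPdist_lt => e e0.
    have K0 : 0 < t0 * H10norm Omega w + 1 by rewrite ltr_wpDl// mulr_ge0// sqrtr_ge0.
    have N1 : \forall x \near t, ball t (e / (t0 * H10norm Omega w + 1)) x.
      by apply: nbhsx_ballx; rewrite divr_gt0.
    have : \forall x \near within `[0, 1]%classic (nbhs t),
        ball t (e / (t0 * H10norm Omega w + 1)) x by apply: cvg_within; exact: N1.
    apply: filterS => x; rewrite /ball/= distrC => xt.
    rewrite sub0r normrN ger0_norm ?sqrtr_ge0// /g -scalerBl H10norm_scale// -mulrBl
      normrM (ger0_norm t00) -mulrA.
    apply: (@le_lt_trans _ _ (`|x - t| * (t0 * H10norm Omega w + 1))).
      by rewrite ler_wpM2l// lerDl.
    by rewrite -ltr_pdivlMr.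
  - by rewrite /g mul0r scale0r.
  - rewrite /energy_pert gL2 expr1n mul1r subr_lt0; apply: le_lt_trans sE.
    by apply/ray/tt0; rewrite in_itv/= ler01 lexx.
have cg (t : R) : t \in `[0, 1] -> {for t, continuous (fun t => energy_pert Omega f r
  mu (g t))}.
  move=> tI.
  have -> : (fun t => energy_pert Omega f r mu (g t)) =
      (fun t => E ((t * t0) *: w)) - (fun t => pert r (t ^+ 2 * s)).
    by apply/funext => x; rewrite /energy_pert gL2.
  have c1 : {for t, continuous (fun t : R => E ((t * t0) *: w))}.
    apply: (@continuous_comp _ _ _ (fun t : R => t * t0) (fun t => E (t *: w))).
      by apply: continuousM; [exact: cvg_id|exact: cvg_cst].
    exact: continuous_energy_ray.
  have c2 : {for t, continuous (fun t : R => pert r (t ^+ 2 * s))}.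
    apply: (@continuous_comp _ _ _ (fun t : R => t ^+ 2 * s) (pert r)).
      by apply: continuousM; [exact: exprn_continuous|exact: cvg_cst].
    by apply: continuous_pert => //; exact: t2s.
  exact: continuousB c1 c2.
(* [mp_level] ranges over attained maxima, so the ray contributes only once its energy is known to
   have a maximum. *)
have cont : {within `[0, 1], continuous (fun t => energy_pert Omega f r mu (g t))}.
  rewrite continuous_subspace_in => t; rewrite inE /= => tI.
  by apply: continuous_subspaceT_for => //; exact: cg.
have [m mI mmax] := EVT_max ler01 cont.
apply: (@le_trans _ _ (energy_pert Omega f r mu (g m))%:E); last by rewrite lee_fin; exact: Eg.
apply: ereal_inf_lbound.
exists (energy_pert Omega f r mu (g m)) => //=.
by exists g => //; split => //; exists m.
Qed.

(** The derivative is unique, so the nonnegative number in [Nplus] is the one computed by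
    [is_derive_energy] at [0]. *)
Lemma Nplus_le w mu : Nplus Omega f mu w ->
  \int[leb]_(x in Omega) (f (w.1 x) * w.1 x) <= H10dot Omega w w.
Proof.
move=> [[hw _] [l dl l0]]; have pw := H10_L2pair hw; have lw := H10_Lp hw.
have D := is_derive_energy oO bO p2 c0 cf f0 cf2 fgrow 0 pw pw lw lw.
move: l0; rewrite -(@derive_val _ _ _ _ _ _ _ dl) (@derive_val _ _ _ _ _ _ _ D).
rewrite mul0r addr0 subr_ge0; congr (_ <= _).
by apply: eq_Rintegral => x _; rewrite mul0r addr0.
Qed.

Lemma solution_Splus u mu l : 0 <= l -> solution Omega f mu u l -> Splus Omega f mu u.
Proof.
move=> l0 [su eu]; split => //; exists l => // v hv.
have hu := su.1; have pu := H10_L2pair hu; have lu := H10_Lp hu.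
have pv := H10_L2pair hv; have lv := H10_Lp hv.
have D := is_derive_energy oO bO p2 c0 cf f0 cf2 fgrow 0 pu pv lu lv.
apply: (is_derive_eq D); rewrite mul0r addr0 (eu v hv).
rewrite (_ : \int[leb]_(x in Omega) (f (u.1 x + 0 * v.1 x) * v.1 x) =
             \int[leb]_(x in Omega) (f (u.1 x) * v.1 x)) ?addrK//.
by apply: eq_Rintegral => x _; rewrite mul0r addr0.
Qed.

Lemma Splus_Nplus mu : 0 < mu -> Splus Omega f mu `<=` Nplus Omega f mu.
Proof.
move=> mu0 w [sw [l l0 dl]]; split => //; exists (l * L2dot Omega w w); first exact/dl/sw.1.
by rewrite sw.2 mulr_ge0// ltW.
Qed.

Lemma perturbation_limit_le u mu l w : 0 < mu -> H10 Omega u ->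
  perturbation_limit Omega f mu u l -> Nplus Omega f mu w -> E u <= E w.
Proof.
move=> mu0 hu [r0 [ur [rn [[r01 crit] [rnr0 _] rny cvgu cvgl]]]] Nw.
have hw := Nw.1.1.
have hN := Nplus_le Nw.
have rn1 k : 1 < rn k by exact: le_lt_trans (rnr0 k).
have ru0 k : 0 < rn k by exact: lt_trans (rn1 k).
pose s k := L2norm Omega (ur (rn k)) ^+ 2 / mu.
have s01 k : 0 <= s k < 1.
  have [[_ lt] _ _] := crit _ (rnr0 k).
  by rewrite divr_ge0 ?sqr_ge0 ?(ltW mu0)//= ltr_pdivrMr// mul1r.
have Ek k : E (ur (rn k)) <= E w + pert (rn k) (s k).
  have [_ _ eqk] := crit _ (rnr0 k).
  have := mp_level_le (rn1 k) mu0 hw Nw.1.2 hN.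
  by rewrite -eqk lee_fin lerBlDr.
have pert0 : pert (rn k) (s k) @[k --> \oo] --> (0 : R).
  have c1 : `|derive1 (pert (rn k)) (s k)| @[k --> \oo] --> `|mu / 2 * l|.
    apply: cvg_norm.
    rewrite (_ : (fun k => _) = (fun k => mu / 2 * (2 / mu * derive1 (pert (rn k)) (s k)))).
      by apply: cvgM => //; exact: cvg_cst.
    by apply/funext => k; field; rewrite gt_eqF.
  have c2 : (rn k)^-1 @[k --> \oo] --> (0 : R).
    by apply/gtr0_cvgV0 => //; exact: nearW.
  have c12 := cvgM c1 c2; rewrite mulr0 in c12.
  apply: (@squeeze_cvgr _ _ _ _ (cst 0)
    (fun k => `|derive1 (pert (rn k)) (s k)| * (rn k)^-1)).
  - apply: nearW => k; apply/andP; split; last exact: pert_le_derive.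
    by apply: pert_ge0; case/andP: (s01 k).
  - exact: cvg_cst.
  - exact: c12.
have pu := H10_L2pair hu; have lu := H10_Lp hu.
have [K K0 lsc] := energy_lsc oO bO p2 c0 cf f0 cf2 fgrow pu lu.
have [C C0 sob] := sobolev_H10 oO bO p2 pcrit.
apply/ler_addgt0Pr => e e0.
(* The error [e] is shared in thirds between the term [e1 * K], the distance [d] from [u] to
   [ur (rn k)], and the perturbation. *)
pose e1 := e / 3 / (K + 1).
have K1 : 0 < K + 1 by rewrite ltr_wpDl.
have e10 : 0 < e1 by rewrite !divr_gt0.
have e1K : e1 * K <= e / 3.
  by rewrite /e1 mulrAC ler_pdivrMr// ler_pM2l ?divr_gt0// lerDl.
have [K' K'0 gap] := lsc e1 e10.
(* With [dl <= 1] both [dl ^+ 2] and [dl ^ p] are at most [dl], so the [d]-terms of [gap] are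
   bounded by [K' * (1 + C) * dl]; the added 1 keeps [L] positive. *)
pose L := K' * (1 + C) + 1.
have L0 : 0 < L by rewrite ltr_wpDl// mulr_ge0// addr_ge0.
pose dl := Num.min 1 (e / 3 / L).
have dl0 : 0 < dl by rewrite lt_min ltr01/= !divr_gt0.
have dl1 : dl <= 1 by rewrite ge_min lexx.
have dlL : dl * L <= e / 3 by rewrite -ler_pdivlMr// ge_min lexx orbT.
have N1 : \forall k \near \oo, `|0 - H10norm Omega (ur (rn k) - u)| < dl.
  by move/cvgrPdist_lt: cvgu; apply.
have N2 : \forall k \near \oo, `|0 - pert (rn k) (s k)| < e / 3.
  by move/cvgrPdist_lt: pert0; apply; rewrite divr_gt0.
have [k [Hk1 Hk2]] : exists k, `|0 - H10norm Omega (ur (rn k) - u)| < dl /\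
    `|0 - pert (rn k) (s k)| < e / 3.
  have : \forall k \near \oo, `|0 - H10norm Omega (ur (rn k) - u)| < dl /\
    `|0 - pert (rn k) (s k)| < e / 3 by near=> k; split; near: k.
  by move=> [k _ /(_ k (leqnn k))]; exists k.
set d := ur (rn k) - u in Hk1.
have hd : H10 Omega d.
  have hur : H10 Omega (ur (rn k)) by have [[]] := crit _ (rnr0 k).
  rewrite /d -scaleN1r; exact: (H10_addZ oO bO (-1) hur hu).
have pd := H10_L2pair hd; have ld := H10_Lp hd.
have dd : H10dot Omega d d <= dl ^+ 2.
  rewrite -H10norm_sqr lerXn2r ?nnegrE ?sqrtr_ge0 ?(ltW dl0)//.
  by apply/ltW/(le_lt_trans _ Hk1); rewrite sub0r normrN ler_norm.
(* Convergence is given in the gradient norm only; the embedding, with [dl] as the bound [G], makes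
   the [L^p] part small too. *)
have [_ Qd] := sob d dl hd dl0 dd.
have ud : u + 1 *: d = ur (rn k) by rewrite scale1r /d addrC subrK.
have := gap d pd ld; rewrite ud.
have dlp : dl `^ p <= dl.
  by apply: ge1r_powR; rewrite ?dl0 ?dl1//; apply/ltW/(lt_trans _ p2); rewrite ltr1n.
have dl2 : dl ^+ 2 <= dl by rewrite expr2 ler_piMl// ltW.
have Cd : C * dl `^ p <= C * dl by rewrite ler_wpM2l.
have := Ek k.
move: dd Qd (ler_norm (pert (rn k) (s k))) Hk2; rewrite sub0r normrN.
move: (E u) (E w) (E (ur (rn k))) (pert (rn k) (s k)) (H10dot Omega d d)
  (\int[leb]_(x in Omega) (`|d.1 x| `^ p)) => Eu Ew Er P D Q dd Qd P1 P2 Er1 Eu1.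
have : K' * (D + Q) <= K' * ((1 + C) * dl).
  by apply: ler_wpM2l => //; move: (C * dl `^ p) Cd Qd => X; lra.
have : K' * ((1 + C) * dl) <= dl * L.
  by rewrite /L mulrA [leLHS]mulrC ler_pM2l// lerDl.
move: (K' * (D + Q)) (K' * ((1 + C) * dl)) (dl * L) (e1 * K) dlL e1K Eu1 => y1 y2 y3 y4.
by lra.
Unshelve. all: by end_near. Qed.

Lemma perturbation_limit_inf u mu l : 0 < mu -> 0 <= l -> solution Omega f mu u l ->
  perturbation_limit Omega f mu u l ->
  (E u)%:E = ereal_inf [set (E w)%:E | w in Splus Omega f mu] /\
  (E u)%:E = ereal_inf [set (E w)%:E | w in Nplus Omega f mu].
Proof.
move=> mu0 l0 su pl.
have Su := solution_Splus l0 su.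
have SN := Splus_Nplus mu0.
have le w : Nplus Omega f mu w -> E u <= E w.
  exact: perturbation_limit_le mu0 su.1.1 pl.
split; apply/eqP; rewrite eq_le; apply/andP; split.
- by apply: le_ereal_inf_tmp => _ [w /SN Nw <-]; rewrite lee_fin; exact: le.
- by apply: ereal_inf_lbound; exists u.
- by apply: le_ereal_inf_tmp => _ [w Nw <-]; rewrite lee_fin; exact: le.
- by apply: ereal_inf_lbound; exists u => //; exact: SN.
Qed.

End mountain_pass.

Unset Implicit Arguments.

Theorem lemma5p1 (R : realType) (N : nat) (Omega : set 'rV[R]_N) (f : R -> R)
    (p K2 Kp mu : R) (u : @sobolev R N) (lam : R) :
  (1 <= N)%N -> smooth_bounded_domain Omega -> continuous f ->
  cond_f1 Omega f p K2 Kp -> cond_f2 f ->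
  (cond_f3 f /\
     (exists2 mu0, existence_threshold Omega f mu0 & 0 < mu < mu0)) \/
  (exists q C, [/\ cond_f4 f q, GN_constant Omega p C, 0 < mu &
                   (mu%:E <= mu_star Omega p K2 Kp C q)%E]) ->
  solution_obtained Omega f mu u lam ->
  (energy Omega f u)%:E =
    ereal_inf [set (energy Omega f w)%:E | w in Splus Omega f mu] /\
  (energy Omega f u)%:E =
    ereal_inf [set (energy Omega f w)%:E | w in Nplus Omega f mu].
Proof.
case: N Omega u => [//|n] Omega u _ [oO _ _ bO _] cf [p2 pcrit /andP[K20 _] Kp0 grow] f2 H.
move=> [su /andP[l0 _] pl].
have mu0 : 0 < mu.
  by case: H => [[_ [mu0 _ /andP[]]]//|[q [C []]]].
have p10 : 1 <= p - 1 by lra.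
(* Read off from the growth condition at [0], where the power vanishes because its exponent [p - 1]
   is nonzero. *)
have f0 : f 0 = 0.
  apply/eqP; rewrite -normr_le0; have := grow 0.
  by rewrite normr0 mulr0 add0r powR0 ?mulr0// gt_eqF// (lt_le_trans ltr01).
have fgrow t : `|f t| <= (K2 + Kp) * (1 + `|t| `^ (p - 1)).
  apply: le_trans (grow t) _.
  (* Since [p - 1 >= 1], the linear term is absorbed and the two constants of (f1) merge into
     [K2 + Kp]. *)
  have tp : `|t| <= 1 + `|t| `^ (p - 1).
    have [t1|/ltW t1] := leP `|t| 1; first by rewrite (le_trans t1)// lerDl powR_ge0.
    by rewrite ler_wpDl// le1r_powR.
  rewrite mulrDl lerD//; first exact: ler_wpM2l.
  by rewrite ler_wpM2l// lerDr.
exact: (perturbation_limit_inf oO bO p2 pcrit (addr_ge0 K20 Kp0) cf f0 f2 fgrow mu0 l0 su pl).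
Qed.
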